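(* Assume that, along the sequence $(\lambda,\Sigma)=(\lambda_n,\Sigma_n)$: (C.1) the eigenvalues of $\Sigma\,(Z^T(I-\tilde A(\lambda))Z+\Sigma)^{-1}\Sigma$ are bounded from above (uniformly in $n$); (C.2) $nR_1(\lambda,\Sigma)\to\infty$ as $n\to\infty$; (C.3) $\{n^{-1}\mathrm{tr}\,A(\lambda,\Sigma)\}^2/\{n^{-1}\mathrm{tr}\,A^2(\lambda,\Sigma)\}\to0$ as $n\to\infty$. Then, as $n\to\infty$, $$V(\lambda,\Sigma)-L_1(\lambda,\Sigma)-\frac1n\varepsilon^T\varepsilon=o_p(L_1(\lambda,\Sigma)).$$
   Context: Model. For each $n$ one observes $Y_i=\eta(x_i)+\mathbf z_i^T\mathbf b+\varepsilon_i$, $i=1,\dots,n$, with fixed design points $x_i\in\mathcal X$ and $\mathbf z_i\in\mathbb R^p$, an unknown (nonrandom) function $\eta$ on $\mathcal X$, random effects $\mathbf b\sim N(\mathbf 0,B)$ in $\mathbb R^p$, and errors $\varepsilon_i\sim N(0,\sigma^2)$ independent of each other and of $\mathbf b$; $\sigma^2>0$ is fixed. The dimension $p$ may depend on $n$; the eigenvalues of the $p\times p$ matrix $B$ are bounded uniformly in $n$. Write $\mathbf Y=(Y_1,\dots,Y_n)^T$, $\boldsymbol\eta=(\eta(x_1),\dots,\eta(x_n))^T$, $\varepsilon=(\varepsilon_1,\dots,\varepsilon_n)^T$, and let $Z$ be the $n\times p$ matrix with rows $\mathbf z_i^T$, so $\mathbf Y=\boldsymbol\eta+Z\mathbf b+\varepsilon$.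 Estimator. Given functions $\xi_1,\dots,\xi_q$ on $\mathcal X$ ($q$ may depend on $n$) and a quadratic roughness functional $J$ (a square seminorm), let $R$ be the $n\times q$ matrix with entries $\xi_j(x_i)$ and $Q$ the $q\times q$ nonnegative definite matrix with entries $J(\xi_j,\xi_k)$. For $\lambda>0$ and a symmetric positive definite $p\times p$ matrix $\Sigma$ (both tuning parameters), one minimizes $(\mathbf Y-R\mathbf c-Z\mathbf b)^T(\mathbf Y-R\mathbf c-Z\mathbf b)+\mathbf b^T\Sigma\mathbf b+n\lambda\,\mathbf c^TQ\mathbf c$ over $\mathbf c,\mathbf b$. It is assumed throughout that the normal equations are solvable, i.e. the columns of $\binom{R^T}{Z^T}$ lie in the column space of $\begin{pmatrix}R^TR+n\lambda Q&R^TZ\\Z^TR&Z^TZ+\Sigma\end{pmatrix}$. $C^+$ denotes the Moore–Penrose inverse of $C$. The smoothing matrix is $$A=A(\lambda,\Sigma)=(R,Z)\begin{pmatrix}R^TR+n\lambda Q&R^TZ\\Z^TR&Z^TZ+\Sigma\end{pmatrix}^{+}\begin{pmatrix}R^T\\Z^T\end{pmatrix},$$ so that the fitted values are $\hat{\mathbf Y}=A\mathbf Y$, and $\tilde A(\lambda)=R(R^TR+n\lambda Q)^+R^T$ is the smoothing matrix when random effects are absent. Loss, risk and generalized cross-validation score: $$L_1(\lambda,\Sigma)=\frac1n\sum_{i=1}^n(\hat Y_i-\eta(x_i)-\mathbf z_i^T\mathbf b)^2,\qquad R_1(\lambda,\Sigma)=E[L_1(\lambda,\Sigma)],$$ where the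 expectation is over $\mathbf b$ and $\varepsilon$, and $$V(\lambda,\Sigma)=\frac{n^{-1}\mathbf Y^T(I-A(\lambda,\Sigma))^2\mathbf Y}{\{n^{-1}\mathrm{tr}(I-A(\lambda,\Sigma))\}^2}.$$ Asymptotics are as $n\to\infty$ along nonrandom sequences $(\lambda,\Sigma)=(\lambda_n,\Sigma_n)$; $X_n=o_p(W_n)$ means $X_n/W_n\to0$ in probability. *)

(* Defs.v *)
From mathcomp Require Import all_boot all_order all_algebra.
From mathcomp Require Import all_classical all_reals all_analysis.

Set Implicit Arguments.
Unset Strict Implicit.
Unset Printing Implicit Defensive.

Import Order.TTheory GRing.Theory Num.Theory.
Import numFieldNormedType.Exports.

Local Open Scope classical_set_scope.
Local Open Scope ring_scope.

Definition posdef (R : realType) (k : nat) (S : 'M[R]_k) : Prop :=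
  S^T = S /\ forall u : 'cV[R]_k, u != 0 -> 0 < (u^T *m S *m u) 0 0.

Definition nonnegdef (R : realType) (k : nat) (S : 'M[R]_k) : Prop :=
  S^T = S /\ forall u : 'cV[R]_k, 0 <= (u^T *m S *m u) 0 0.

(* The square seminorm is f |-> J f f; J is the associated semi-inner product.
   It only has to be one on a linear space H of functions, since a roughness
   functional is finite on part of X -> R only; the values of J off H are
   irrelevant. *)
Record semi_inner_product_on (R : realType) (X : Type) (H : set (X -> R))
    (J : (X -> R) -> (X -> R) -> R) : Prop := SemiInnerProductOn {
  sip_dom0 : H (fun=> 0) ;
  sip_domP : forall (a : R) (f g : X -> R),
    H f -> H g -> H (fun t => a * f t + g t) ;
  sip_sym : forall f g : X -> R, H f -> H g -> J f g = J g f ;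
  sip_lin : forall (a : R) (f g h : X -> R), H f -> H g -> H h ->
    J (fun t => a * f t + g t) h = a * J f h + J g h ;
  sip_ge0 : forall f : X -> R, H f -> 0 <= J f f }.

Definition penrose (R : realType) (m n : nat) (C : 'M[R]_(m, n))
    (G : 'M[R]_(n, m)) : Prop :=
  [/\ C *m G *m C = C, G *m C *m G = G,
      (C *m G)^T = C *m G & (G *m C)^T = G *m C].

Definition mpinv (R : realType) (m n : nat) (C : 'M[R]_(m, n)) :
    'M[R]_(n, m) :=
  xget 0 [set G | penrose C G].

Lemma gram_unit (R : realType) (r n : nat) (M : 'M[R]_(r, n)) :
  row_free M -> M *m M^T \in unitmx.
Proof.
move=> Mf; rewrite -row_free_unit; apply: inj_row_free => v vM0.
set y := v *m M; have : (y *m y^T) 0 0 = 0.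
  by rewrite /y trmx_mul mulmxA -(mulmxA v) vM0 mul0mx mxE.
have yE i : y 0 i * y^T i 0 = y 0 i ^+ 2 by rewrite [y^T _ _]mxE expr2.
rewrite mxE (eq_bigr _ (fun i _ => yE i)) => /eqP.
rewrite psumr_eq0 => [/allP y0|i _]; last exact: sqr_ge0.
have vM : v *m M = 0.
  apply/rowP => i; rewrite [RHS]mxE; apply/eqP.
  by have := y0 i (mem_index_enum _); rewrite implyTb sqrf_eq0.
case/row_freeP: Mf => M' MM'.
by rewrite -[v]mulmx1 -MM' mulmxA vM mul0mx.
Qed.

Lemma penrose_factor (R : realType) (m k n : nat) (c : 'M[R]_(m, k))
    (r : 'M[R]_(k, n)) : row_full c -> row_free r ->
  penrose (c *m r)
    (r^T *m invmx (r *m r^T) *m (invmx (c^T *m c) *m c^T)).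
Proof.
move=> cf rf.
have rU : r *m r^T \in unitmx by exact: gram_unit.
have cU : c^T *m c \in unitmx.
  by rewrite -{2}(trmxK c); apply: gram_unit; rewrite /row_free mxrank_tr.
set d := invmx (r *m r^T); set e := invmx (c^T *m c).
have dT : d^T = d by rewrite trmx_inv trmx_mul trmxK.
have eT : e^T = e by rewrite trmx_inv trmx_mul trmxK.
have rd : r *m (r^T *m d) = 1%:M by rewrite mulmxA mulmxV.
have ec : (e *m c^T) *m c = 1%:M by rewrite -mulmxA mulVmx.
have CG : c *m r *m (r^T *m d *m (e *m c^T)) = c *m (e *m c^T).
  by rewrite -mulmxA (mulmxA r) rd mul1mx.
have GC : r^T *m d *m (e *m c^T) *m (c *m r) = r^T *m d *m r.
  by rewrite -mulmxA (mulmxA _ c) ec mul1mx.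
split.
- by rewrite CG -(mulmxA c) (mulmxA _ c r) ec mul1mx.
- by rewrite GC -(mulmxA _ r) (mulmxA r) rd mul1mx.
- by rewrite CG !trmx_mul trmxK eT -mulmxA.
- by rewrite GC !trmx_mul trmxK dT mulmxA.
Qed.

Lemma penrose_ex (R : realType) (m n : nat) (C : 'M[R]_(m, n)) :
  exists G, penrose C G.
Proof.
have := penrose_factor (col_base_full C) (row_base_free C).
by rewrite mulmx_base => PG; eexists; exact: PG.
Qed.

Lemma penrose_uniq (R : realType) (m n : nat) (C : 'M[R]_(m, n)) G1 G2 :
  penrose C G1 -> penrose C G2 -> G1 = G2.
Proof.
move=> [a1 b1 c1 d1] [a2 b2 c2 d2].
have CG : C *m G1 = C *m G2.
  have -> : C *m G1 = (C *m G1 *m (C *m G2))^T.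
    by rewrite trmx_mul c1 c2 mulmxA a2.
  by rewrite mulmxA a1 c2.
have GC : G1 *m C = G2 *m C.
  have -> : G1 *m C = (G2 *m C *m (G1 *m C))^T.
    by rewrite trmx_mul d1 d2 -mulmxA (mulmxA C) a2.
  by rewrite -mulmxA (mulmxA C) a1 d2.
by rewrite -b1 GC -mulmxA CG mulmxA b2.
Qed.

Lemma mpinvP (R : realType) (m n : nat) (C : 'M[R]_(m, n)) :
  penrose C (mpinv C).
Proof.
by rewrite /mpinv; case: xgetP => [G _ //|no]; have [G /no] := penrose_ex C.
Qed.

Definition basis_mx (R : realType) (X : Type) (n q : nat)
    (xi : 'I_q -> X -> R) (x : 'I_n -> X) : 'M[R]_(n, q) :=
  \matrix_(i, j) xi j (x i).

Definition penalty_mx (R : realType) (X : Type) (q : nat)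
    (J : (X -> R) -> (X -> R) -> R) (xi : 'I_q -> X -> R) : 'M[R]_q :=
  \matrix_(j, k) J (xi j) (xi k).

Section smoothing.
Variables (R : realType) (n p q : nat).
Variables (F : 'M[R]_(n, q)) (Q : 'M[R]_q) (lambda : R).
Variables (Z : 'M[R]_(n, p)) (Sigma : 'M[R]_p).

Definition normal_eq_mx : 'M[R]_(q + p) :=
  block_mx (F^T *m F + (n%:R * lambda) *: Q) (F^T *m Z)
           (Z^T *m F)                        (Z^T *m Z + Sigma).

(* %MS compares row spaces, hence the transposes. *)
Definition normal_eq_solvable : bool :=
  ((col_mx F^T Z^T)^T <= normal_eq_mx^T)%MS.

Definition smoothing_mx : 'M[R]_n :=
  row_mx F Z *m mpinv normal_eq_mx *m col_mx F^T Z^T.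

Definition fixed_smoothing_mx : 'M[R]_n :=
  F *m mpinv (F^T *m F + (n%:R * lambda) *: Q) *m F^T.

End smoothing.

Section scores.
Variables (R : realType) (n : nat) (A : 'M[R]_n).

(* [eta] is the fixed part and [u] the random part Z b of the mean of Y. *)
Definition loss (eta u Y : 'cV[R]_n) : R :=
  n%:R^-1 * \sum_i ((A *m Y) i 0 - eta i 0 - u i 0) ^+ 2.

Definition gcv (Y : 'cV[R]_n) : R :=
  (n%:R^-1 * (Y^T *m ((1%:M - A) *m (1%:M - A)) *m Y) 0 0) /
  (n%:R^-1 * \tr (1%:M - A)) ^+ 2.

End scores.

(* [normal_prob] takes a standard deviation and is not a point mass when this
   is 0, whence the case split. *)
Definition centered_normal (R : realType) (v : R) (A : set R) : \bar R :=
  if v == 0 then \d_(0 : R) A else normal_prob 0 (Num.sqrt v) A.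

Section gaussian.
Context (R : realType) (d : measure_display) (T : measurableType d).
Variable P : probability T R.

(* Only measurable sets are compared: measures are total functions here, with
   unspecified values elsewhere. *)
Definition centered_normal_rv (v : R) (f : T -> R) : Prop :=
  forall A : set R, measurable A -> P (f @^-1` A) = centered_normal v A.

Definition tuple_col (p : nat) (t : p.-tuple R) : 'cV[R]_p :=
  \col_j tnth t j.

(* b ~ N(0, B), B being possibly singular: all linear combinations u^T b are
   N(0, u^T B u). *)
Definition centered_normal_rvec (p : nat) (B : 'M[R]_p)
    (b : {RV P >-> p.-tuple R}) : Prop :=
  nonnegdef B /\
  forall u : 'cV[R]_p, centered_normal_rv ((u^T *m B *m u) 0 0)
    (fun w => (u^T *m tuple_col (b w)) 0 0).

(* Mutual independence of the n + 1 variables b, eps_1, ..., eps_n, b being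
   vector-valued; the product rule for subfamilies is obtained by taking some
   of the sets to be setT. *)
Definition mutually_independent (p n : nat) (b : {RV P >-> p.-tuple R})
    (eps : 'I_n -> {RV P >-> R}) : Prop :=
  forall (A : set (p.-tuple R)) (E : 'I_n -> set R),
    measurable A -> (forall i, measurable (E i)) ->
    P (b @^-1` A `&` \bigcap_i (eps i @^-1` E i)) =
    (P (b @^-1` A) * \prod_i P (eps i @^-1` E i))%E.

End gaussian.

(* X_n = o_p(W_n): for all e > 0, P(|X_n / W_n| > e) --> 0. Clearing the
   denominator makes W_n = 0 <> X_n count as |X_n / W_n| > e, while division
   in R would give X_n / 0 = 0. *)
Definition little_op (R : realType) (d : nat -> measure_display)
    (T : forall n, measurableType (d n)) (P : forall n, probability (T n) R)
    (X W : forall n, T n -> R) : Prop :=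
  forall e : R, 0 < e ->
    P n [set w | e * `|W n w| < `|X n w|] @[n --> \oo] --> 0%E.

(* Main.v *)
From HB Require Import structures.
Require Import Defs.
From mathcomp Require Import all_boot all_order all_algebra.
From mathcomp Require Import all_classical all_reals all_analysis.
From mathcomp Require Import measurable_realfun ring lra.
Import Order.TTheory GRing.Theory Num.Theory.
Import numFieldNormedType.Exports.
Local Open Scope classical_set_scope.
Local Open Scope ring_scope.

Set Implicit Arguments.
Unset Strict Implicit.
Unset Printing Implicit Defensive.

(** Write m = eta + Z b for the mean of the observations, L and R for the loss
    and the risk, V for the score, and mu = tr A / n. Expanding squares,

      |(I - A) Y|^2 = n L + |eps|^2 + 2 eps.(I - A) m - 2 eps.A eps.

    Dividing by (1 - mu)^2 = 1 / (1 + g) turns this into n V. So n V - n L -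
    |eps|^2 is a combination of the centered variables eps.(I - A) m,
    eps.A eps - sigma^2 tr A and g (|eps|^2 - n sigma^2), of g n L, and of a
    constant. Since g = 2 mu + O(mu^2), the terms of order n mu in that
    constant, 2 mu n sigma^2 from the denominator and - 2 sigma^2 tr A from the
    mean of - 2 eps.A eps, cancel: this is the idea of generalized
    cross-validation, and only n O(mu^2) is left ([gcv_loss_gap_le]). The
    condition on tr A and tr A^2 gives mu -> 0 and n mu^2 = o(tr A^2), while
    sigma^2 tr A^2 <= n R ([smoother_trace_ratio], [nrisk_ge_traceAA]). The
    variances of the three centered variables are O(n R); as n R -> oo,
    Chebyshev's inequality makes the variables o_p(n R).

    It remains to pass from R to L, that is, to bound the variance of n L by
    O(n R) as well ([nloss_concentration]). Here n L is the squared norm of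
    an affine function of the vector (b, eps), whose covariance matrix
    (I - A) Z B Z^T (I - A) + sigma^2 A^2 has to have bounded eigenvalues. This is
    what the conditions on B and on Sigma (Z^T (I - At) Z + Sigma)^-1 Sigma are for:
    the latter matrix dominates Z^T (I - A)^2 Z ([residual_random_effects]).
    Bounded eigenvalues bound the quadratic form by [rayleigh].

    All the random variables are polynomials of degree at most two in
    (b, eps), so that only moments of order at most four of its linear forms
    occur. A sum of two independent variables satisfies E X = 0, E X^2 = v,
    E X^4 = 3 v^2 when each of them does ([gauss4_add]), so these identities
    hold for every linear form of (b, eps), and polarization yields all joint
    moments of order four ([isserlis]). *)

(** * Real random variables with a given mean *)

Section mean.
Context {d : measure_display} {T : measurableType d} {R : realType}.
Variable P : {measure set T -> \bar R}.

(** The equation alone would not do: the integral is a total function, so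
    integrability has to be carried along for means to add up. *)
Definition has_mean (f : T -> R) (m : R) : Prop :=
  P.-integrable setT (EFin \o f) /\ (\int[P]_w (f w)%:E = m%:E)%E.

Lemma has_meanD f g a b : has_mean f a -> has_mean g b ->
  has_mean (fun w => f w + g w) (a + b).
Proof.
move=> [If Ef] [Ig Eg]; split.
  by have := integrableD measurableT If Ig; apply: eq_integrable.
under eq_integral do rewrite EFinD.
by rewrite integralD_EFin// Ef Eg.
Qed.

Lemma has_meanZ f a c : has_mean f a -> has_mean (fun w => c * f w) (c * a).
Proof.
move=> [If Ef]; split.
  by have := integrableZl measurableT c If; apply: eq_integrable.
under eq_integral do rewrite EFinM.
by rewrite integralZl// Ef.
Qed.

Lemma has_mean0 : has_mean (fun=> 0) 0.
Proof. split; [exact: integrable0|exact: integral0]. Qed.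

Lemma has_mean_sum (I : Type) (r : seq I) (Q : pred I) (f : I -> T -> R) (a : I -> R) :
  (forall i, Q i -> has_mean (f i) (a i)) ->
  has_mean (fun w => \sum_(i <- r | Q i) f i w) (\sum_(i <- r | Q i) a i).
Proof.
move=> fa; elim: r => [|i r IH].
  rewrite big_nil; under [X in has_mean X]funext do rewrite big_nil.
  exact: has_mean0.
rewrite big_cons; under [X in has_mean X]funext do rewrite big_cons.
by case: ifP => // Qi; apply: has_meanD => //; exact: fa.
Qed.

Lemma eq_has_mean f g a b : f =1 g -> a = b -> has_mean f a -> has_mean g b.
Proof. by move=> /funext -> ->. Qed.

Lemma has_mean_ge0 (f : T -> R) (a : R) : measurable_fun setT f -> (forall w, 0 <= f w) ->
  (\int[P]_w (f w)%:E = a%:E)%E -> has_mean f a.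
Proof.
move=> mf f0 Ef; split=> //; apply/integrableP; split.
  exact/measurable_EFinP.
under eq_integral do rewrite /= ger0_norm//.
by rewrite Ef ltry.
Qed.

Lemma has_mean_measurable (f : T -> R) a : has_mean f a -> measurable_fun setT f.
Proof. by move=> [/measurable_int/measurable_EFinP]. Qed.

End mean.

Section measurability.
Context {R : realType}.

Lemma continuous_pos_part : continuous (fun x : R => Num.max x 0).
Proof.
by move=> x; apply: (@continuous_max _ _ id (fun=> 0)) => //; exact: cvg_cst.
Qed.

Lemma measurable_pos_part : measurable_fun setT (fun x : R => Num.max x 0).
Proof. by apply: continuous_measurable_fun; exact: continuous_pos_part. Qed.

Lemma measurable_neg_part : measurable_fun setT (fun x : R => Num.max (- x) 0).
Proof. by apply: (measurableT_comp measurable_pos_part); exact: oppr_measurable. Qed.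

Lemma pos_part_ge0 (x : R) : 0 <= Num.max x 0.
Proof. by rewrite le_max lexx orbT. Qed.

Lemma measurable_lt_norm d (T : measurableType d) (f : T -> R) (c : R) :
  measurable_fun setT f -> measurable [set w | c < `|f w|].
Proof.
move=> mf; rewrite (_ : mkset _ = (fun w => `|f w|) @^-1` `]c, +oo[); last first.
  by apply/seteqP; split=> w /=; rewrite in_itv/= andbT.
rewrite -[_ @^-1` _]setTI; apply: (_ : measurable_fun setT (fun w => `|f w|)) => //.
exact: measurableT_comp.
Qed.

End measurability.

(** * Moments of the centered normal law *)

Section normal_moments.
Context {R : realType}.
Notation mu := (@lebesgue_measure R).

Lemma ge0_integral_normal_prob (m s : R) (f : R -> \bar R) :
  measurable_fun setT f -> (forall x, 0 <= f x)%E ->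
  (\int[normal_prob m s]_x f x = \int[mu]_x (f x * (normal_pdf m s x)%:E))%E.
Proof.
move=> mf f0.
rewrite -(Radon_Nikodym_SigmaFinite.change_of_variables (normal_prob_dominates m s))//=.
have mpdf : measurable_fun [set: R] (fun x => (normal_pdf m s x)%:E).
  by apply/measurable_EFinP; exact: measurable_normal_pdf.
have mrn : mu.-integrable setT (Radon_Nikodym_SigmaFinite.f (normal_prob m s) mu).
  exact/Radon_Nikodym_SigmaFinite.f_integrable/normal_prob_dominates.
apply: ae_eq_integral => //.
- by apply: emeasurable_funM => //; exact: measurable_int mrn.
- exact: emeasurable_funM.
apply: ae_eqe_mul2l; apply: integral_ae_eq => //= E _ mE.
rewrite -Radon_Nikodym_SigmaFinite.f_integral//.
exact: normal_prob_dominates.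
Qed.

(** Monotone convergence reduces integrals over the line to integrals over
    compact intervals, where the fundamental theorem of calculus applies. *)
Lemma cvg_integral_sym_itv (h : R -> R) : continuous h -> (forall x, 0 <= h x) ->
  (\int[mu]_(x in `[(- n.+1%:R)%R, n.+1%:R%R]) (h x)%:E @[n --> \oo] -->
   \int[mu]_x (h x)%:E)%E.
Proof.
move=> ch h0.
pose F (n : nat) : set R := `[- n.+1%:R, n.+1%:R]%classic.
have mh : measurable_fun setT (EFin \o h).
  by apply/measurable_EFinP; exact: continuous_measurable_fun.
have <- : \bigcup_n F n = setT.
  rewrite -subTset => x _; exists (Num.truncn `|x|); first by [].
  apply: (_ : x \in `[- (Num.truncn `|x|).+1%:R, (Num.truncn `|x|).+1%:R]).
  rewrite in_itv/= -ler_norml ltW//.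
  by have /andP[] := truncn_itv (normr_ge0 x).
apply: ge0_nondecreasing_set_cvg_integral => //.
- apply/nondecreasing_seqP => n; rewrite subsetEset => x.
  rewrite /F/= !in_itv/= => /andP[a b]; apply/andP; split.
    by rewrite (le_trans _ a)// lerN2 ler_nat.
  by rewrite (le_trans b)// ler_nat.
- by move=> i; exact: measurable_funTS.
- by move=> n x _; rewrite lee_fin.
Qed.

(** Integration by parts, [h1 - c h2] being the integrand that has an
    antiderivative; its increments over [[-n, n]] tend to zero.
    Nonnegativity of [h1] spares a proof that it is integrable. *)
Lemma integral_by_antiderivative (h1 h2 F : R -> R) (c m : R) :
  continuous h1 -> continuous h2 ->
  (forall x, 0 <= h1 x) -> (forall x, 0 <= h2 x) ->
  (forall x : R, is_derive x (1 : R) F (h1 x - c * h2 x)) ->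
  (F n.+1%:R - F (- n.+1%:R)) @[n --> \oo] --> (0 : R) ->
  (\int[mu]_x (h2 x)%:E = m%:E)%E -> (\int[mu]_x (h1 x)%:E = (c * m)%:E)%E.
Proof.
move=> c1 c2 p1 p2 dF F0 h2m.
have cF : continuous F.
  move=> x; have [+ _] := dF x => /derivable1_diffP dFx.
  exact: differentiable_continuous dFx.
pose I n : set R := `[- n.+1%:R, n.+1%:R]%classic.
have int h n : continuous h -> mu.-integrable (I n) (EFin \o h).
  move=> ch; apply: continuous_compact_integrable; first exact: segment_compact.
  by apply: continuous_subspaceT.
have E n : (\int[mu]_(x in I n) (h1 x)%:E =
   c%:E * \int[mu]_(x in I n) (h2 x)%:E + (F n.+1%:R - F (- n.+1%:R))%:E)%E.
  have FT : (\int[mu]_(x in I n) ((h1 x)%:E - (c * h2 x)%:E) =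
             (F n.+1%:R)%:E - (F (- n.+1%:R))%:E)%E.
    apply: (@continuous_FTC2 R (fun x => h1 x - c * h2 x)).
    - by rewrite -subr_gt0 opprK -natrD ltr0n.
    - apply: continuous_subspaceT => x; apply: cvgB; first exact: c1.
      by apply: cvgM; [exact: cvg_cst|exact: c2].
    - split.
      + by move=> x _; have [] := dF x.
      + exact/cvg_at_right_filter/cF.
      + exact/cvg_at_left_filter/cF.
    - by move=> x _; rewrite derive1E; have [_ ->] := dF x.
  have i2 : mu.-integrable (I n) (EFin \o (fun x => c * h2 x)).
    by apply: int => x; apply: cvgM; [exact: cvg_cst|exact: c2].
  have mI : @measurable _ (measurableTypeR R) (I n) by exact: measurable_itv.
  have := @integralB_EFin _ (measurableTypeR R) R _ _ _ _ mI (int _ n c1) i2; rewrite FT => EB.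
  rewrite EFinB EB -(integralZl mI (int _ n c2)) addeCA subee ?adde0//.
  exact: (integrable_fin_num mI (integrableZl mI c (int _ n c2))).
apply: (cvg_unique (@ereal_hausdorff _) (cvg_integral_sym_itv c1 p1)).
have K : (fun n => c%:E * \int[mu]_(x in I n) (h2 x)%:E +
    (F n.+1%:R - F (- n.+1%:R))%:E)%E @ \oo --> (c%:E * m%:E + 0%:E)%E.
  apply: cvgeD; first by rewrite fin_num_adde_defl.
  - by apply: cvgeZl => //; rewrite -h2m; exact: cvg_integral_sym_itv.
  - by apply: cvg_EFin => //; exact: nearW.
by move: K; rewrite adde0 -EFinM -(funext E); exact.
Qed.

Lemma integral_oppr (h : R -> R) : continuous h -> (forall x, 0 <= h x) ->
  (\int[mu]_x (h (- x))%:E = \int[mu]_x (h x)%:E)%E.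
Proof.
move=> ch h0.
have cN : continuous (h \o -%R).
  by move=> x; apply: continuous_comp; [exact: opp_continuous|exact: ch].
apply: (cvg_unique (@ereal_hausdorff _) (cvg_integral_sym_itv cN (fun x => h0 (- x)))).
have K := cvg_integral_sym_itv ch h0.
suff E n : (\int[mu]_(x in `[(- n.+1%:R)%R, n.+1%:R%R]) (h x)%:E =
           \int[mu]_(x in `[(- n.+1%:R)%R, n.+1%:R%R]) ((h \o -%R) x)%:E)%E.
  by move: K; rewrite (funext E); exact.
rewrite -[in LHS](opprK n.+1%:R) integration_by_substitution_oppr ?opprK//.
  by rewrite -subr_ge0 opprK addr_ge0.
exact: continuous_subspaceT.
Qed.

Lemma cvg_harmonicM (c : R) : (c / n.+1%:R) @[n --> \oo] --> (0 : R).
Proof.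
rewrite -(mulr0 c); apply: cvgM; [exact: cvg_cst|exact: cvg_harmonic].
Qed.

Section moments.
Variables (s : R) (s0 : 0 < s).
Notation k := (normal_pdf 0 s).

Lemma normal_pdf0E :
  k = (fun x : R => normal_peak s * expR (- x ^+ 2 / (s ^+ 2 *+ 2))).
Proof.
rewrite normal_pdfE ?gt_eqF//; apply/funext => x.
by rewrite /normal_fun subr0.
Qed.

Lemma is_derive_normal_pdf (x : R) :
  is_derive x (1 : R) k (- (x / s ^+ 2) * k x).
Proof.
rewrite normal_pdf0E.
have D1 : is_derive x (1 : R) (fun x : R => - x ^+ 2 / (s ^+ 2 *+ 2)) (- (x / s ^+ 2)).
  rewrite [X in is_derive _ _ X](_ : _ = (- (s ^+ 2 *+ 2)^-1) *: (@id R ^+ 2)); last first.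
    by apply/funext => y; rewrite !fctE/= /GRing.scale/= mulrC mulrN mulNr.
  apply: is_derive_eq; rewrite /GRing.scale/=; field; by rewrite gt_eqF.
have D2 := is_derive1_comp (is_derive_expR _) D1.
have := is_deriveZ (normal_peak s) D2.
move=> H; rewrite [X in is_derive _ _ X](_ : _ = normal_peak s *:
  (expR \o (fun x : R => - x ^+ 2 / (s ^+ 2 *+ 2)))) //.
by apply: is_derive_eq; rewrite /GRing.scale/=; ring.
Qed.

(** A crude bound, from [t ^ 2 / 2 <= exp t] at [t = x ^ 2 / (2 s ^ 2)]; it makes the
    boundary terms [x k x] and [x ^ 3 k x] vanish at infinity. *)
Lemma normal_pdf_decay (x : R) : 0 < x ->
  x ^+ 3 * k x <= normal_peak s * (s ^+ 4 *+ 8) / x.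
Proof.
move=> x0; rewrite normal_pdf0E mulrCA -mulrA ler_wpM2l ?normal_peak_ge0//.
rewrite mulNr expRN.
set t := x ^+ 2 / _.
have t0 : 0 < t by rewrite divr_gt0 ?exprn_gt0// pmulrn_lgt0 ?exprn_gt0.
have tE : t ^+ 2 / 2 <= expR t.
  by have := expR_ge1Dxn 1 (ltW t0); apply: le_trans; rewrite lerDr.
rewrite ler_pdivrMr ?expR_gt0//.
apply: (@le_trans _ _ (s ^+ 4 *+ 8 / x * (t ^+ 2 / 2))); last first.
  rewrite ler_wpM2l// (divr_ge0 _ (ltW x0))// mulrn_wge0//.
  exact: exprn_ge0 (ltW s0).
rewrite /t le_eqVlt; apply/orP; left; apply/eqP; field.
by rewrite !gt_eqF.
Qed.

Let cX (n : nat) : continuous (fun x : R => x ^+ n * k x).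
Proof.
move=> x; apply: cvgM; first exact: exprn_continuous.
by apply: continuous_normal_pdf; rewrite gt_eqF.
Qed.

Let k_even x : k (- x) = k x.
Proof. by rewrite normal_pdf0E sqrrN. Qed.

Let boundary_vanishes (n : nat) (c : R) : (n <= 3)%N -> odd n ->
  (c * (n0.+1%:R ^+ n * k n0.+1%:R) - c * ((- n0.+1%:R) ^+ n * k (- n0.+1%:R)))
    @[n0 --> \oo] --> (0 : R).
Proof.
move=> n3 on.
rewrite [X in X @ _ --> _](_ : _ = (fun m : nat =>
  c *+ 2 * (m.+1%:R ^+ n * k m.+1%:R))); last first.
  apply/funext => m; rewrite exprNn -signr_odd on expr1 k_even; ring.
rewrite -[X in _ --> X](mulr0 (c *+ 2)); apply: cvgM; first exact: cvg_cst.
apply: (squeeze_cvgr _ (cvg_cst 0) (cvg_harmonicM (normal_peak s * (s ^+ 4 *+ 8)))).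
apply: nearW => m; rewrite mulr_ge0 ?exprn_ge0 ?normal_pdf_ge0//=.
apply: le_trans (normal_pdf_decay (ltr0Sn _ _)).
by rewrite ler_wpM2r ?normal_pdf_ge0// ler_weXn2l// ler1n.
Qed.

(** [- s ^ 2 x k x] is an antiderivative of [x ^ 2 k x - s ^ 2 k x]. *)
Lemma integral_normal_pdf_sqr :
  (\int[mu]_x (x ^+ 2 * k x)%:E = (s ^+ 2)%:E)%E.
Proof.
rewrite -[s ^+ 2]mulr1.
apply: (@integral_by_antiderivative _ k (fun x => - s ^+ 2 * (x ^+ 1 * k x))).
- exact: cX.
- by apply: continuous_normal_pdf; rewrite gt_eqF.
- by move=> x; rewrite mulr_ge0 ?sqr_ge0 ?normal_pdf_ge0.
- by move=> x; rewrite normal_pdf_ge0.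
- move=> x; have Dk := is_derive_normal_pdf x.
  rewrite [X in is_derive _ _ X](_ : _ = (- s ^+ 2) *: ((@id R ^+ 1) * k)) //.
  by apply: is_derive_eq; rewrite /GRing.scale/= ?fctE/=; field; rewrite gt_eqF.
- exact: boundary_vanishes.
- exact: integral_normal_pdf.
Qed.

(** [- s ^ 2 x ^ 3 k x] is an antiderivative of [x ^ 4 k x - 3 s ^ 2 x ^ 2 k x]. *)
Lemma integral_normal_pdf_pow4 :
  (\int[mu]_x (x ^+ 4 * k x)%:E = (3 * s ^+ 4)%:E)%E.
Proof.
rewrite (_ : 3 * s ^+ 4 = (3 * s ^+ 2) * s ^+ 2); last by ring.
apply: (@integral_by_antiderivative _ (fun x => x ^+ 2 * k x)
  (fun x => - s ^+ 2 * (x ^+ 3 * k x))).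
- exact: cX.
- exact: cX.
- by move=> x; rewrite mulr_ge0 ?exprn_even_ge0 ?normal_pdf_ge0.
- by move=> x; rewrite mulr_ge0 ?sqr_ge0 ?normal_pdf_ge0.
- move=> x; have Dk := is_derive_normal_pdf x.
  rewrite [X in is_derive _ _ X](_ : _ = (- s ^+ 2) *: ((@id R ^+ 3) * k)) //.
  by apply: is_derive_eq; rewrite /GRing.scale/= ?fctE/=; field; rewrite gt_eqF.
- exact: boundary_vanishes.
- exact: integral_normal_pdf_sqr.
Qed.

End moments.

End normal_moments.

Section mean_probability.
Context {d : measure_display} {T : measurableType d} {R : realType}.
Variable P : probability T R.

Lemma has_mean_cst (c : R) : has_mean P (fun=> c) c.
Proof.
split; first exact: finite_measure_integrable_cst.
by rewrite integral_cst//= probability_setT mule1.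
Qed.

Lemma integrable_le (f g : T -> R) m : measurable_fun setT f ->
  (forall w, `|f w| <= g w) -> has_mean P g m -> P.-integrable setT (EFin \o f).
Proof.
move=> mf fg [Ig _]; apply: (le_integrable measurableT _ _ Ig).
  exact/measurable_EFinP.
move=> x _; rewrite /= lee_fin.
by rewrite (le_trans (fg x))// ler_norm.
Qed.

Lemma integrable_has_mean (f : T -> R) : P.-integrable setT (EFin \o f) ->
  exists m, has_mean P f m.
Proof.
move=> If; exists (fine (\int[P]_w (f w)%:E)); split=> //.
by rewrite fineK//; exact: (integrable_fin_num measurableT If).
Qed.

Lemma has_mean_uniq (f : T -> R) a b : has_mean P f a -> has_mean P f b -> a = b.
Proof. by move=> [_ fa] [_]; rewrite fa => -[]. Qed.

End mean_probability.

Section centered_normal_moments.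
Context {d : measure_display} {T : measurableType d} {R : realType}.
Variable P : probability T R.
Notation mu := (@lebesgue_measure R).

(** The part of normality that the proof uses. Unlike normality, it passes to
    sums of independent variables by a mere expansion of the fourth power. *)
Record gauss4 (f : T -> R) (v : R) : Prop := Gauss4 {
  gauss4_meas : measurable_fun setT f;
  gauss4_mean : has_mean P f 0;
  gauss4_sqr : has_mean P (fun w => f w ^+ 2) v;
  gauss4_pow4 : has_mean P (fun w => f w ^+ 4) (3 * v ^+ 2) }.

Lemma ge0_integral_same_law (m : probability (measurableTypeR R) R) (f : T -> R)
    (mf : measurable_fun setT f) :
  (forall A : set R, measurable A -> P (f @^-1` A) = m A) ->
  forall g : R -> \bar R, measurable_fun setT g -> (forall x, 0 <= g x)%E ->
  (\int[P]_w g (f w) = \int[m]_x g x)%E.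
Proof.
move=> fm g mg g0.
pose X : {mfun T >-> measurableTypeR R} :=
  HB.pack (f : T -> measurableTypeR R)
    (isMeasurableFun.Build _ _ _ (measurableTypeR R) f mf).
rewrite -[LHS](@ge0_integral_distribution _ _ _ _ _ P X g)//.
apply: eq_measure_integral => A mA _; exact: fm.
Qed.

(** The mean vanishes because the positive and the negative part of the
    variable have the same mean, by symmetry of the density. The case [v = 0]
    is treated apart, the law being then a point mass. *)
Lemma centered_normal_gauss4 (f : T -> R) (v : R) : 0 <= v ->
  measurable_fun setT f -> centered_normal_rv P v f -> gauss4 f v.
Proof.
move=> v0 mf fv.
have mX n : measurable_fun setT (fun x : R => (x ^+ n)%:E).
  by apply/measurable_EFinP; exact: exprn_measurable.
have mfX n : measurable_fun setT (fun w => f w ^+ n).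
  exact: measurable_funX.
have mmax := @measurable_pos_part R; have mmaxN := @measurable_neg_part R.
have [v00|vn0] := eqVneq v 0.
  pose m0 : probability (measurableTypeR R) R :=
    @dirac _ (measurableTypeR R) (0 : R) R.
  have D : forall A : set R, measurable A -> P (f @^-1` A) = m0 A.
    by move=> A mA; rewrite fv// /centered_normal v00 eqxx.
  have E := ge0_integral_same_law (m := m0) mf D.
  have Ee n : has_mean P (fun w => f w ^+ (n.+1).*2) 0.
    apply: has_mean_ge0 => //.
      by move=> w; rewrite exprn_even_ge0// odd_double.
    rewrite (E (fun x => (x ^+ (n.+1).*2)%:E))//; last first.
      by move=> x; rewrite lee_fin exprn_even_ge0// odd_double.
    by rewrite integral_dirac ?expr0n/= ?mule0//; exact: mX.
  have f0 : has_mean P f 0.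
    have If : P.-integrable setT (EFin \o f).
      apply: (integrable_le mf _ (has_meanD (has_mean_cst P 1) (Ee 0%N))) => w.
      by rewrite ler_norml; apply/andP; split; nra.
    split=> //.
    rewrite integralE.
    have -> : (fun w => (f w)%:E)^\+%E = (fun w => (Num.max (f w) 0)%:E).
      by apply/funext => w; rewrite funeposE EFin_max.
    have -> : (fun w => (f w)%:E)^\-%E = (fun w => (Num.max (- f w) 0)%:E).
      by apply/funext => w; rewrite funenegE EFin_max.
    rewrite (E (fun x => (Num.max x 0)%:E)) ?(E (fun x => (Num.max (- x) 0)%:E)).
    - by rewrite !integral_dirac// ?oppr0 ?maxxx ?mule0 ?sube0//; exact/measurable_EFinP.
    - exact/measurable_EFinP.
    - by move=> x; rewrite lee_fin le_max lexx orbT.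
    - exact/measurable_EFinP.
    - by move=> x; rewrite lee_fin le_max lexx orbT.
  by split => //; [rewrite v00; exact: (Ee 0%N)|rewrite v00 expr0n/= mulr0; exact: (Ee 1%N)].
pose s := Num.sqrt v; have s0 : 0 < s by rewrite sqrtr_gt0 lt_def vn0.
have s2 : s ^+ 2 = v by exact: sqr_sqrtr.
have D : forall A : set R, measurable A -> P (f @^-1` A) = normal_prob 0 s A.
  by move=> A mA; rewrite fv// /centered_normal (negbTE vn0).
have E (g : R -> R) : measurable_fun setT g -> (forall x, 0 <= g x) ->
   (\int[P]_w (g (f w))%:E = \int[mu]_x (g x * normal_pdf 0 s x)%:E)%E.
  move=> mg g0; rewrite (ge0_integral_same_law (m := normal_prob 0 s) mf D (g := EFin \o g))//.
    rewrite ge0_integral_normal_prob//.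
    exact/measurable_EFinP.
  exact/measurable_EFinP.
have E2 : has_mean P (fun w => f w ^+ 2) v.
  apply: has_mean_ge0 => //; first by move=> w; exact: sqr_ge0.
  rewrite (E (fun x => x ^+ 2)) ?integral_normal_pdf_sqr ?s2//.
  by move=> x; exact: sqr_ge0.
split => //; last first.
  apply: has_mean_ge0 => //; first by move=> w; rewrite exprn_even_ge0.
  rewrite (E (fun x => x ^+ 4)) ?integral_normal_pdf_pow4 -?s2 -?exprM//.
  by move=> x; rewrite exprn_even_ge0.
have If : P.-integrable setT (EFin \o f).
  apply: (integrable_le mf _ (has_meanD (has_mean_cst P 1) E2)) => w.
  by rewrite ler_norml; apply/andP; split; nra.
split=> //; rewrite integralE.
have EP : (\int[P]_w (fun w => (f w)%:E)^\+ w =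
   \int[mu]_x (Num.max x 0 * normal_pdf 0 s x)%:E)%E.
  rewrite -(E (fun x => Num.max x 0))//; last by move=> x; rewrite le_max lexx orbT.
  apply: eq_integral => w _; by rewrite funeposE EFin_max.
have EN : (\int[P]_w (fun w => (f w)%:E)^\- w =
   \int[mu]_x (Num.max (- x) 0 * normal_pdf 0 s x)%:E)%E.
  rewrite -(E (fun x => Num.max (- x) 0))//; last by move=> x; rewrite le_max lexx orbT.
  apply: eq_integral => w _; by rewrite funenegE EFin_max.
rewrite EP EN.
rewrite -[X in (_ - X)%E](_ :
  (\int[mu]_x (Num.max x 0 * normal_pdf 0 s x)%:E = _)%E); last first.
  rewrite -(@integral_oppr _ (fun x => Num.max x 0 * normal_pdf 0 s x)).
  - by apply: eq_integral => x _; rewrite normal_pdf0E// sqrrN.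
  - move=> x; apply: cvgM; [exact: continuous_pos_part|].
    by apply: continuous_normal_pdf; rewrite gt_eqF.
  - by move=> x; rewrite mulr_ge0 ?normal_pdf_ge0// le_max lexx orbT.
rewrite -EP subee//.
exact: integrable_pos_fin_num.
Qed.

End centered_normal_moments.

(** * Sums of independent variables *)

Section independence.
Context {d : measure_display} {T : measurableType d} {R : realType}.
Variable P : probability T R.

Definition indep (U V : T -> R) : Prop := forall A E : set R,
  measurable A -> measurable E ->
  P (U @^-1` A `&` V @^-1` E) = (P (U @^-1` A) * P (V @^-1` E))%E.

Lemma indep_comp (U V : T -> R) (g h : R -> R) : indep U V ->
  measurable_fun setT g -> measurable_fun setT h ->
  indep (fun w => g (U w)) (fun w => h (V w)).
Proof.
move=> UV mg mh A E mA mE.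
have mgA : measurable (g @^-1` A) by rewrite -[_ @^-1` _]setTI; exact: mg.
have mhE : measurable (h @^-1` E) by rewrite -[_ @^-1` _]setTI; exact: mh.
exact: UV mgA mhE.
Qed.

(** By uniqueness of the product measure, independence says that the joint law is
    the product of the laws, so that Tonelli's theorem applies. *)
Lemma ge0_integralM_indep (U V : T -> R) :
  measurable_fun setT U -> measurable_fun setT V ->
  (forall w, 0 <= U w) -> (forall w, 0 <= V w) -> indep U V ->
  (\int[P]_w (U w * V w)%:E = \int[P]_w (U w)%:E * \int[P]_w (V w)%:E)%E.
Proof.
move=> mU mV U0 V0 UV.
pose XU : {mfun T >-> R} := HB.pack U (isMeasurableFun.Build _ _ _ _ U mU).
pose XV : {mfun T >-> R} := HB.pack V (isMeasurableFun.Build _ _ _ _ V mV).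
have mUV : measurable_fun setT (fun w => (U w, V w)) by exact: measurable_fun_pair.
pose XUV : {mfun T >-> (R * R)%type} :=
  HB.pack (fun w => (U w, V w)) (isMeasurableFun.Build _ _ _ _ _ mUV).
pose h (x : R) : \bar R := (Num.max x 0)%:E.
have mh : measurable_fun setT h.
  by apply/measurable_EFinP; exact: measurable_pos_part.
have h0 x : (0 <= h x)%E by rewrite lee_fin pos_part_ge0.
have hU w : h (U w) = (U w)%:E by rewrite /h max_l.
have hV w : h (V w) = (V w)%:E by rewrite /h max_l.
pose g (z : R * R) : \bar R := (h z.1 * h z.2)%E.
have mg : measurable_fun setT g.
  by apply: emeasurable_funM; apply: measurableT_comp.
have g0 z : (0 <= g z)%E by rewrite mule_ge0.
transitivity (\int[distribution P XUV]_z g z)%E.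
  rewrite (@ge0_integral_distribution _ _ _ _ _ P XUV g)//.
  by apply: eq_integral => w _; rewrite EFinM -hU -hV.
transitivity (\int[distribution P XU \x distribution P XV]_z g z)%E.
  apply: eq_measure_integral => A mA _; apply/esym.
  apply: product_measure_unique => // B C mB mC; exact: UV.
rewrite fubini_tonelli1//.
transitivity (\int[distribution P XU]_x (h x * \int[distribution P XV]_y h y))%E.
  by apply: eq_integral => x _; rewrite /fubini_F /g/= ge0_integralZl//.
rewrite ge0_integralZr//; last by apply: integral_ge0.
rewrite !ge0_integral_distribution//; congr (_ * _)%E.
- by apply: eq_integral => w _; rewrite -hU.
- by apply: eq_integral => w _; rewrite -hV.
Qed.

Lemma has_meanM_ge0 (U V : T -> R) (a b : R) : measurable_fun setT U ->
  measurable_fun setT V -> (forall w, 0 <= U w) -> (forall w, 0 <= V w) ->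
  indep U V -> has_mean P U a -> has_mean P V b ->
  has_mean P (fun w => U w * V w) (a * b).
Proof.
move=> mU mV U0 V0 UV [_ Ea] [_ Eb]; apply: has_mean_ge0.
- exact: measurable_funM.
- by move=> w; rewrite mulr_ge0.
- by rewrite ge0_integralM_indep// Ea Eb EFinM.
Qed.

Lemma has_mean_posneg (f : T -> R) a : measurable_fun setT f -> has_mean P f a ->
  exists ap an, [/\ has_mean P (fun w => Num.max (f w) 0) ap,
    has_mean P (fun w => Num.max (- f w) 0) an & a = ap - an].
Proof.
move=> mf [If Ef].
have mmax := @measurable_pos_part R.
have [|ap Hp] := @integrable_has_mean _ _ _ P (fun w => Num.max (f w) 0).
  apply: le_integrable If => //.
    by apply/measurable_EFinP; exact: (measurableT_comp mmax).
  move=> w _; rewrite lee_fin ger0_norm ?le_max ?lexx ?orbT//.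
  by rewrite ge_max ler_norm normr_ge0.
have [|an Hn] := @integrable_has_mean _ _ _ P (fun w => Num.max (- f w) 0).
  apply: le_integrable If => //.
    apply/measurable_EFinP; apply: (measurableT_comp mmax).
    exact: measurableT_comp.
  move=> w _; rewrite lee_fin ger0_norm ?le_max ?lexx ?orbT//.
  by rewrite ge_max -normrN ler_norm normr_ge0.
exists ap, an; split=> //.
apply: (@has_mean_uniq _ _ _ P f) => //.
apply: eq_has_mean (has_meanD Hp (has_meanZ (-1) Hn)) => [w|]; last by rewrite mulN1r.
rewrite mulN1r /Num.max; case: ifPn => h1; case: ifPn => h2; lra.
Qed.

(** The nonnegative case applies to the positive and negative parts, whose
    products have finite means. *)
Lemma has_meanM (U V : T -> R) (a b : R) : measurable_fun setT U ->
  measurable_fun setT V -> indep U V -> has_mean P U a -> has_mean P V b ->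
  has_mean P (fun w => U w * V w) (a * b).
Proof.
move=> mU mV UV Ua Vb.
have mp := @measurable_pos_part R; have mn := @measurable_neg_part R.
have [ap [an [Hap Han ->]]] := has_mean_posneg mU Ua.
have [bp [bn [Hbp Hbn ->]]] := has_mean_posneg mV Vb.
have K (g h : R -> R) c e : measurable_fun setT g -> measurable_fun setT h ->
    (forall x, 0 <= g x) -> (forall x, 0 <= h x) ->
    has_mean P (fun w => g (U w)) c -> has_mean P (fun w => h (V w)) e ->
    has_mean P (fun w => g (U w) * h (V w)) (c * e).
  move=> mg mh g0 h0 gc he; apply: has_meanM_ge0 => //.
  - exact: (measurableT_comp mg mU).
  - exact: (measurableT_comp mh mV).
  - exact: indep_comp.
have ge0p (x : R) := pos_part_ge0 x; have ge0n (x : R) := pos_part_ge0 (- x).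
have pp := K _ _ _ _ mp mp ge0p ge0p Hap Hbp.
have pn := K _ _ _ _ mp mn ge0p ge0n Hap Hbn.
have np := K _ _ _ _ mn mp ge0n ge0p Han Hbp.
have nn := K _ _ _ _ mn mn ge0n ge0n Han Hbn.
apply: eq_has_mean (has_meanD (has_meanD pp nn)
   (has_meanZ (-1) (has_meanD pn np))) => [w|]; last by ring.
have E (x : R) : x = Num.max x 0 - Num.max (- x) 0.
  rewrite /Num.max; case: ifPn => h1; case: ifPn => h2; lra.
rewrite [in RHS](E (U w)) [in RHS](E (V w)); ring.
Qed.

(** Expand the second and fourth powers: the terms that contain [X] or [Y] to the
    first power have mean zero, whatever the third moments are, and
    [3 s ^ 2 + 6 s t + 3 t ^ 2 = 3 (s + t) ^ 2]. *)
Lemma gauss4_add (X Y : T -> R) (s t : R) : gauss4 P X s -> gauss4 P Y t ->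
  indep X Y -> gauss4 P (fun w => X w + Y w) (s + t).
Proof.
move=> [mX X1 X2 X4] [mY Y1 Y2 Y4] XY.
have mX_ n : measurable_fun setT (fun w => X w ^+ n) by exact: measurable_funX.
have mY_ n : measurable_fun setT (fun w => Y w ^+ n) by exact: measurable_funX.
have mpow n : measurable_fun setT (fun x : R => x ^+ n) by exact: exprn_measurable.
have third (Z : T -> R) m : measurable_fun setT Z ->
    has_mean P (fun w => Z w ^+ 4) m -> exists c, has_mean P (fun w => Z w ^+ 3) c.
  move=> mZ Z4; apply: integrable_has_mean.
  apply: (integrable_le _ _ (has_meanD (has_mean_cst P 1) Z4)).
    exact: measurable_funX.
  move=> w; have := sqr_ge0 (Z w ^+ 2 - Z w); have := sqr_ge0 (Z w ^+ 2 + Z w).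
  have := sqr_ge0 (Z w ^+ 2 - 1).
  by rewrite ler_norml => *; apply/andP; split; nra.
have [x3 X3] := third _ _ mX X4; have [y3 Y3] := third _ _ mY Y4.
have I i j : indep (fun w => X w ^+ i) (fun w => Y w ^+ j).
  exact: (indep_comp XY (mpow i) (mpow j)).
have XY1 := has_meanM mX mY XY X1 Y1.
have X3Y := has_meanM (mX_ 3) (mY_ 1) (I 3 1) X3 Y1.
have XY3 := has_meanM (mX_ 1) (mY_ 3) (I 1 3) X1 Y3.
have X2Y2 := has_meanM (mX_ 2) (mY_ 2) (I 2 2) X2 Y2.
split.
- exact: measurable_funD.
- by rewrite -[0]addr0; exact: has_meanD.
- apply: eq_has_mean (has_meanD (has_meanD X2 Y2) (has_meanZ 2 XY1)) => [w|]; ring.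
- apply: eq_has_mean (has_meanD (has_meanD X4 Y4) (has_meanD (has_meanZ 6 X2Y2)
    (has_meanZ 4 (has_meanD X3Y XY3)))) => [w|]; ring.
Qed.

Lemma gauss4_scale (X : T -> R) (s c : R) : gauss4 P X s ->
  gauss4 P (fun w => c * X w) (c ^+ 2 * s).
Proof.
move=> [mX X1 X2 X4]; split.
- exact: measurable_funM.
- by rewrite -(mulr0 c); exact: has_meanZ.
- by apply: eq_has_mean (has_meanZ (c ^+ 2) X2) => [w|//]; ring.
- by apply: eq_has_mean (has_meanZ (c ^+ 4) X4) => [w|]; ring.
Qed.

End independence.

Section mutual_independence.
Context {d : measure_display} {T : measurableType d} {R : realType}.
Variables (P : probability T R) (p n : nat).
Variables (b : {RV P >-> p.-tuple R}) (eps : 'I_n -> {RV P >-> R}).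
Hypothesis b_eps : mutually_independent b eps.

(** A pi-system that generates the events depending only on [b] and on the
    errors other than the [k]-th one. *)
Definition rectangles (k : 'I_n) : set (set T) :=
  [set S | exists (A : set (p.-tuple R)) (E : 'I_n -> set R),
     [/\ measurable A, forall i, measurable (E i), E k = setT &
         S = b @^-1` A `&` \bigcap_i (eps i @^-1` E i)]].

Lemma rectangles_setI (k : 'I_n) : setI_closed (rectangles k).
Proof.
move=> _ _ [A [E [mA mE Ek ->]]] [A' [E' [mA' mE' Ek' ->]]].
exists (A `&` A'), (fun i => E i `&` E' i); split.
- exact: measurableI.
- by move=> i; exact: measurableI.
- by rewrite Ek Ek' setIT.
- apply/seteqP; split=> [w [[bA EE] [bA' EE']]|w [[bA bA'] EE]].
    by split=> // i _; split; [exact: EE|exact: EE'].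
  by split; split=> // i _; have [] := EE i I.
Qed.

Lemma measurable_rectangle k S : rectangles k S -> measurable S.
Proof.
move=> [A [E [mA mE Ek ->]]]; apply: measurableI.
  exact: measurable_funPTI.
by apply: fin_bigcap_measurable => // i _; exact: measurable_funPTI.
Qed.

Lemma rectangle_indep k S (F : set R) : rectangles k S -> measurable F ->
  P (S `&` eps k @^-1` F) = (P S * P (eps k @^-1` F))%E.
Proof.
move=> [A [E [mA mE Ek ->]]] mF.
pose E' i := if i == k then F else E i.
have mE' i : measurable (E' i) by rewrite /E'; case: ifP.
rewrite b_eps// (_ : _ `&` _ `&` _ = b @^-1` A `&` \bigcap_i (eps i @^-1` E' i)); last first.
  rewrite -setIA; congr (_ `&` _); apply/seteqP; split=> [w [EE Fk] i _|w EE].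
    by rewrite /E'; case: eqP => [->//|_]; exact: EE.
  split=> [i _|]; last by have := EE k I; rewrite /E' eqxx.
  by have := EE i I; rewrite /E'; case: eqP => // -> _; rewrite Ek.
rewrite b_eps// -muleA; congr (_ * _)%E.
rewrite (bigD1 k)//= [in RHS](bigD1 k)//= {1}/E' eqxx Ek preimage_setT.
rewrite probability_setT mul1e muleC; congr (_ * _)%E.
by apply: eq_bigr => i /negbTE ik; rewrite /E' ik.
Qed.

(** Dynkin's theorem: the events independent of [eps k] form a lambda-system,
    which contains the pi-system of rectangles. *)
Lemma sigma_rectangles_indep k S (F : set R) : <<s rectangles k >> S ->
  measurable F -> measurable S /\
  P (S `&` eps k @^-1` F) = (P S * P (eps k @^-1` F))%E.
Proof.
move=> GS mF.
have mkF : measurable (eps k @^-1` F) by exact: measurable_funPTI.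
pose H := [set S : set T | measurable S /\
  P (S `&` eps k @^-1` F) = (P S * P (eps k @^-1` F))%E].
suff : <<s rectangles k >> `<=` H by move=> /(_ S GS).
apply: lambda_system_subset => //.
- exact: rectangles_setI.
- apply/dynkin_lambda_system; split.
  + by split=> //; rewrite setTI probability_setT mul1e.
  + move=> A [mA PA]; split; first exact: measurableC.
    have PF : P (eps k @^-1` F) \is a fin_num by exact: fin_num_measure.
    have -> : ~` A `&` eps k @^-1` F = eps k @^-1` F `\` (A `&` eps k @^-1` F).
      by rewrite setDIr setDv setU0 setDE setIC.
    rewrite measureD//; last 2 first.
      exact: measurableI.
      by rewrite ltey_eq PF.
    rewrite setICA setIid.
    transitivity (P (eps k @^-1` F) - P A * P (eps k @^-1` F))%E.
      by congr (_ - _)%E; exact: PA.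
    rewrite probability_setC//.
    by rewrite muleBl ?mul1e// ?fin_num_adde_defr// fin_num_measure.
  + move=> A tA HA; split; first by apply: bigcup_measurable => i _; have [] := HA i.
    have mA i : measurable (A i) by have [] := HA i.
    have tAF : trivIset setT (fun i => A i `&` eps k @^-1` F).
      exact: trivIset_setIr.
    have mAF i : measurable (A i `&` eps k @^-1` F) by exact: measurableI.
    rewrite setI_bigcupl !measure_bigcup//.
    have PF : (fine (P (eps k @^-1` F)))%:E = P (eps k @^-1` F).
      by rewrite fineK// fin_num_measure.
    rewrite -PF muleC -nneseriesZl//; apply: eq_eseriesr => i _.
    by rewrite muleC PF; have [] := HA i.
- move=> S' rS'; split; first exact: measurable_rectangle rS'.
  exact: rectangle_indep.
Qed.

(** The first variable is measurable for the sigma-algebra generated by the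
    rectangles, since [eps k] does not enter it. *)
Lemma mutually_independent_linear k (u : 'cV[R]_p) (a : 'I_n -> R) (r : seq 'I_n) :
  k \notin r ->
  indep P (fun w => (u^T *m tuple_col (b w)) 0 0 + \sum_(i <- r) a i * eps i w)
          (eps k).
Proof.
move=> kr A F mA mF.
pose G := g_sigma_algebraType (rectangles k).
pose f (w : G) := (u^T *m tuple_col (b w)) 0 0 + \sum_(i <- r) a i * eps i w.
suff mf : measurable_fun [set: G] f.
  have [|_] := @sigma_rectangles_indep k (f @^-1` A) F _ mF; last by [].
  by rewrite -[_ @^-1` _]setTI; exact: mf.
have mb : measurable_fun [set: G] (b : G -> p.-tuple R).
  move=> _ A' mA'; apply: sub_sigma_algebra; exists A', (fun=> setT); split=> //.
  apply/seteqP; split=> [w [_ bA]|w [bA _]] //.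
have me i : i != k -> measurable_fun [set: G] (eps i : G -> R).
  move=> ik _ F' mF'; apply: sub_sigma_algebra.
  exists setT, (fun j => if j == i then F' else setT); split=> //.
  - by move=> j; case: ifP.
  - by rewrite eq_sym (negbTE ik).
  - apply/seteqP; split=> [w [_ eF]|w [_ /(_ i I)]]; last by rewrite eqxx.
    by split=> // j _; case: eqP => [->|].
rewrite /f; apply: measurable_funD.
  under eq_fun do rewrite mxE; apply: measurable_sum => j.
  apply: measurable_funM => //; under eq_fun do rewrite mxE.
  exact: (measurableT_comp (measurable_tnth j) mb).
elim: r kr {f} => [_|i r IH] /=.
  under eq_fun do rewrite big_nil.
  exact: measurable_cst.
rewrite inE negb_or => /andP[ki /IH mr].
under eq_fun do rewrite big_cons; apply: measurable_funD => //.
by apply: measurable_funM => //; apply: me; rewrite eq_sym.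
Qed.

(** The errors are added one by one, each being independent of the sum of
    [b] and the previous ones. *)
Lemma gauss4_linear (B : 'M[R]_p) (s2 : R) : 0 <= s2 ->
  centered_normal_rvec B b -> (forall i, centered_normal_rv P s2 (eps i)) ->
  forall (u : 'cV[R]_p) (a : 'cV[R]_n),
  gauss4 P (fun w => (u^T *m tuple_col (b w)) 0 0 + \sum_i a i 0 * eps i w)
    ((u^T *m B *m u) 0 0 + s2 * \sum_i a i 0 ^+ 2).
Proof.
move=> s20 [[_ B0] Nb] Ne u a.
have gb : gauss4 P (fun w => (u^T *m tuple_col (b w)) 0 0) ((u^T *m B *m u) 0 0).
  apply: centered_normal_gauss4 => //.
  under eq_fun do rewrite mxE; apply: measurable_sum => j.
  apply: measurable_funM => //; under eq_fun do rewrite mxE.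
  exact: (measurableT_comp (measurable_tnth j)).
have ge i : gauss4 P (eps i) s2 by apply: centered_normal_gauss4.
rewrite mulr_sumr; elim: (index_enum _) (index_enum_uniq 'I_n) => [_|i r IH] /=.
  by rewrite big_nil addr0; under eq_fun do rewrite big_nil addr0.
move=> /andP[ir /IH gr].
have := @mutually_independent_linear i u (fun i => a i 0) r ir.
move=> /(indep_comp (g := id) (h := fun x => a i 0 * x)) ind.
have := gauss4_add gr (gauss4_scale (a i 0) (ge i)) (ind _ _).
rewrite big_cons [s2 * _]mulrC [a i 0 ^+ 2 * s2 + _]addrC addrA.
rewrite (_ : (fun w => _) = (fun w => (u^T *m tuple_col (b w)) 0 0 +
  \sum_(i0 <- i :: r) a i0 0 * eps i0 w)); last first.
  by apply/funext => w; rewrite big_cons [a i 0 * _ + _]addrC addrA.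
by apply; [exact: measurable_id|exact: measurable_funM].
Qed.

End mutual_independence.

(** * Inner products and symmetric matrices *)

Section forms.
Context {R : realType}.

Definition bilin (m n : nat) (S : 'M[R]_(m, n)) (u : 'cV[R]_m) (v : 'cV[R]_n) : R :=
  (u^T *m S *m v) 0 0.

Definition dot (n : nat) (u v : 'cV[R]_n) : R := (u^T *m v) 0 0.

Lemma dotE n (u v : 'cV[R]_n) : dot u v = \sum_i u i 0 * v i 0.
Proof. by rewrite /dot mxE; apply: eq_bigr => i _; rewrite mxE. Qed.

Lemma dotC n (u v : 'cV[R]_n) : dot u v = dot v u.
Proof. by rewrite !dotE; apply: eq_bigr => i _; rewrite mulrC. Qed.

Lemma dotDl n (u v w : 'cV[R]_n) : dot (u + v) w = dot u w + dot v w.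
Proof. by rewrite /dot linearD mulmxDl mxE. Qed.

Lemma dotDr n (u v w : 'cV[R]_n) : dot u (v + w) = dot u v + dot u w.
Proof. by rewrite /dot mulmxDr mxE. Qed.

Lemma dotZl n a (u w : 'cV[R]_n) : dot (a *: u) w = a * dot u w.
Proof. by rewrite /dot linearZ -scalemxAl mxE. Qed.

Lemma dotZr n a (u w : 'cV[R]_n) : dot u (a *: w) = a * dot u w.
Proof. by rewrite /dot -scalemxAr mxE. Qed.

Lemma dotNl n (u w : 'cV[R]_n) : dot (- u) w = - dot u w.
Proof. by rewrite -scaleN1r dotZl mulN1r. Qed.

Lemma dotNr n (u w : 'cV[R]_n) : dot u (- w) = - dot u w.
Proof. by rewrite -scaleN1r dotZr mulN1r. Qed.

Lemma dot0r n (u : 'cV[R]_n) : dot u 0 = 0.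
Proof. by rewrite /dot mulmx0 mxE. Qed.

Lemma dot_mulmx m n (S : 'M[R]_(m, n)) u v : dot (S *m u) v = dot u (S^T *m v).
Proof. by rewrite /dot trmx_mul mulmxA. Qed.

Lemma dot_ge0 n (u : 'cV[R]_n) : 0 <= dot u u.
Proof. by rewrite dotE sumr_ge0// => i _; rewrite -expr2 sqr_ge0. Qed.

Lemma dot_eq0 n (u : 'cV[R]_n) : dot u u = 0 -> u = 0.
Proof.
rewrite dotE => /psumr_eq0P u0; apply/colP => i; rewrite mxE.
by apply/eqP; rewrite -sqrf_eq0 expr2 u0// => j _; rewrite -expr2 sqr_ge0.
Qed.

Lemma bilinE m n (S : 'M[R]_(m, n)) u v : bilin S u v = dot u (S *m v).
Proof. by rewrite /bilin /dot mulmxA. Qed.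

Lemma dot_delta_mx n (i : 'I_n) (v : 'cV[R]_n) : dot (delta_mx i 0) v = v i 0.
Proof. by rewrite /dot trmx_delta -rowE mxE. Qed.

Lemma dot_mx_delta n (S : 'M[R]_n) i : dot (delta_mx i 0) (S *m delta_mx i 0) = S i i.
Proof. by rewrite dot_delta_mx -colE mxE. Qed.

(** A semi-inner product: when [v] is isotropic, nonnegativity of the form at
    [x u - (a + 1) / 2 v], where [a] is the value of the form at [u] and [x] the product
    of [u] and [v], forces [x = 0]. *)
Lemma Cauchy_Schwarz_form n (S : 'M[R]_n) (u v : 'cV[R]_n) : nonnegdef S ->
  dot u (S *m v) ^+ 2 <= dot u (S *m u) * dot v (S *m v).
Proof.
move=> [Sym S0].
have q0 (x : 'cV[R]_n) : 0 <= dot x (S *m x) by rewrite -bilinE; exact: S0.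
have sy : dot v (S *m u) = dot u (S *m v) by rewrite -{1}Sym -dot_mulmx dotC.
have qE (a b : R) : dot (a *: u + b *: v) (S *m (a *: u + b *: v)) =
    a ^+ 2 * dot u (S *m u) + 2 * a * b * dot u (S *m v) + b ^+ 2 * dot v (S *m v).
  rewrite mulmxDr -!scalemxAr !dotDl !dotDr !dotZl !dotZr sy; ring.
set x := dot u (S *m v) in sy qE *.
set a := dot u (S *m u) in qE *; set c := dot v (S *m v) in qE *.
have a0 : 0 <= a by exact: q0.
have : 0 <= c by exact: q0.
rewrite le_eqVlt => /orP[/eqP c0|c0].
  rewrite -c0 mulr0; have := q0 (x *: u + (- (a + 1) / 2) *: v).
  rewrite qE -c0 mulr0 addr0.
  have -> : x ^+ 2 * a + 2 * x * (- (a + 1) / 2) * x = - x ^+ 2 by field.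
  by rewrite oppr_ge0.
have := q0 (c *: u + (- x) *: v); rewrite qE.
have -> : c ^+ 2 * a + 2 * c * - x * x + (- x) ^+ 2 * c = c * (a * c - x ^+ 2) by ring.
by rewrite pmulr_rge0// subr_ge0.
Qed.

Lemma nonnegdef1 n : nonnegdef (1%:M : 'M[R]_n).
Proof. by split=> [|u]; [rewrite trmx1|rewrite mulmx1; exact: dot_ge0]. Qed.

Lemma Cauchy_Schwarz n (u v : 'cV[R]_n) : dot u v ^+ 2 <= dot u u * dot v v.
Proof. by have := Cauchy_Schwarz_form u v (nonnegdef1 n); rewrite !mul1mx. Qed.

(** Cauchy-Schwarz for the form [H] between [v] and [H v]. *)
Lemma nonnegdef_sqr_le n (H : 'M[R]_n) (k : R) : nonnegdef H ->
  (forall v, dot v (H *m v) <= k * dot v v) ->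
  forall v, dot (H *m v) (H *m v) <= k * dot v (H *m v).
Proof.
move=> Hn Hk v; set y := H *m v; have [HT H0] := Hn.
have vy : dot v (H *m y) = dot y y by rewrite -{1}HT -dot_mulmx.
have := Cauchy_Schwarz_form v y Hn; rewrite vy => CS.
have vv : 0 <= dot v (H *m v) by rewrite -bilinE; exact: H0.
have [y0|y0] := eqVneq (dot y y) 0.
  rewrite y0; have yz := dot_eq0 y0; rewrite -/y yz dot0r mulr0//.
have yp : 0 < dot y y by rewrite lt_def y0 dot_ge0.
rewrite -(ler_pM2r yp) -expr2 (le_trans CS)// -/y.
by rewrite mulrAC mulrC -/y ler_wpM2r.
Qed.

(** A matrix and its transpose have the same operator norm. *)
Lemma operator_bound_tr m n (G : 'M[R]_(m, n)) (k : R) : 0 <= k ->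
  (forall u, dot (G *m u) (G *m u) <= k * dot u u) ->
  forall v, dot (G^T *m v) (G^T *m v) <= k * dot v v.
Proof.
move=> k0 Gk v; set y := G^T *m v.
have vy : dot v (G *m y) = dot y y by rewrite dotC dot_mulmx.
have := Cauchy_Schwarz v (G *m y); rewrite vy => CS.
have [y0|y0] := eqVneq (dot y y) 0; first by rewrite y0 mulr_ge0 ?dot_ge0.
have yp : 0 < dot y y by rewrite lt_def y0 dot_ge0.
rewrite -(ler_pM2r yp) -expr2 (le_trans CS)//.
by rewrite [leRHS]mulrAC [leRHS]mulrC ler_wpM2l ?dot_ge0.
Qed.

End forms.

Section rayleigh.
Context {R : realType}.

(** The form attains its maximum [m] on the unit sphere at some [c]. Then
    [m - S] is nonnegative definite and isotropic at [c], so [c] is in its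
    kernel by Cauchy-Schwarz; that is, [m] is an eigenvalue. *)
Lemma rayleigh (p : nat) (S : 'M[R]_p) (K : R) : S^T = S ->
  (forall a, eigenvalue S a -> a <= K) ->
  forall v, dot v (S *m v) <= K * dot v v.
Proof.
case: p S => [|p] S SymS eigK v.
  by rewrite !dotE !big_ord0 mulr0.
have cf (M : 'M[R]_p.+1) : continuous (fun w : 'rV[R]_p.+1 => dot w^T (M *m w^T)).
  rewrite (_ : (fun w => _) =
    (fun w : 'rV[R]_p.+1 => \sum_i w 0 i * \sum_j M i j * w 0 j)); last first.
    apply/funext => w; rewrite dotE; apply: eq_bigr => i _; rewrite !mxE.
    by congr (_ * _); apply: eq_bigr => j _; rewrite mxE.
  apply: continuous_big => [|i _]; first exact: add_continuous.
  move=> w; apply: continuousM; first exact: coord_continuous.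
  move: w; apply: continuous_big => [|j _]; first exact: add_continuous.
  by move=> w; apply: continuousM; [exact: cst_continuous|exact: coord_continuous].
pose sph := [set w : 'rV[R]_p.+1 | dot w^T (1%:M *m w^T) = 1].
have sph0 : sph !=set0.
  by exists (delta_mx 0 0); rewrite /sph/= trmx_delta dot_mx_delta mxE eqxx.
have csph : compact sph.
  apply: bounded_closed_compact.
    exists 1; split; first exact: num_real.
    move=> y y1 w; rewrite /sph/= mul1mx dotE => w1.
    rewrite (_ : `|w| = mx_norm w)// mx_normrE; apply: bigmax_le.
      by rewrite ltW// (lt_trans _ y1).
    move=> [i j] _ /=; rewrite ord1 (le_trans _ (ltW y1))//.
    rewrite -(ler_pXn2r (n := 2)) ?nnegrE// expr1n -w1 real_normK ?num_real//.
    rewrite (bigD1 j)//= !mxE -expr2 lerDl sumr_ge0// => k _.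
    by rewrite -expr2 sqr_ge0.
  apply: (@closed_comp _ _ _ [set (1 : R)]) => [w _|]; first exact: cf.
  exact: closed_eq.
have [c cs cmax] := compact_EVT_max sph0 csph (continuous_subspaceT (cf S)).
move: cs; rewrite inE /sph/= mul1mx => c1.
set m := dot c^T (S *m c^T) in cmax.
have Sm u : dot u (S *m u) <= m * dot u u.
  have [u0|u0] := eqVneq (dot u u) 0.
    by rewrite u0 (dot_eq0 u0) mulmx0 dot0r mulr0.
  have up : 0 < dot u u by rewrite lt_def u0 dot_ge0.
  pose r := (Num.sqrt (dot u u))^-1.
  have r2 : r * r * dot u u = 1.
    by rewrite -expr2 exprVn sqr_sqrtr ?dot_ge0// mulVf.
  have := cmax (r *: u)^T; rewrite inE /sph/= mul1mx trmxK => /(_ _).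
  rewrite -scalemxAr !dotZl !dotZr => /(_ _)/= H.
  rewrite -ler_pdivrMr//.
  have -> : dot u (S *m u) / dot u u = r * (r * dot u (S *m u)).
    by rewrite mulrA -expr2 exprVn sqr_sqrtr ?dot_ge0// mulrC.
  by apply: H; rewrite mulrA.
have mP : nonnegdef (m%:M - S).
  split; first by rewrite linearB/= tr_scalar_mx SymS.
  move=> u; rewrite -/(bilin _ u u) bilinE mulmxBl dotDr dotNr mul_scalar_mx dotZr.
  by rewrite subr_ge0.
have zero : dot c^T ((m%:M - S) *m c^T) = 0.
  by rewrite mulmxBl dotDr dotNr mul_scalar_mx dotZr c1 mulr1 subrr.
have ev : (m%:M - S) *m c^T = 0.
  apply: dot_eq0; set y := _ *m _.
  have := Cauchy_Schwarz_form y c^T mP; rewrite -/y zero mulr0.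
  by move=> h; apply/eqP; rewrite -sqrf_eq0; apply/eqP/le_anti; rewrite h sqr_ge0.
have mK : m <= K.
  apply: eigK; apply/eigenvalueP; exists c.
    have := congr1 trmx ev; rewrite trmx_mul trmxK linearB/= tr_scalar_mx SymS.
    rewrite trmx0 mulmxBr mul_mx_scalar => /eqP; rewrite subr_eq0 => /eqP.
    by move=> <-.
  apply/eqP => c0; move: c1; rewrite c0 trmx0 dot0r => /esym/eqP.
  by rewrite oner_eq0.
by rewrite (le_trans (Sm v))// ler_wpM2r ?dot_ge0.
Qed.

End rayleigh.

(** * Penalized least squares smoothers *)

Section smoothers.
Context {R : realType}.

(** For a symmetric matrix, this says that the eigenvalues lie in [[0, 1]]. *)
Definition smoother n (A : 'M[R]_n) : Prop :=
  A^T = A /\ forall v, dot (A *m v) (A *m v) <= dot v (A *m v).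

Lemma smoother_ge0 n (A : 'M[R]_n) v : smoother A -> 0 <= dot v (A *m v).
Proof. by move=> [_ /(_ v)]; apply: le_trans; exact: dot_ge0. Qed.

Lemma smoother_compl n (A : 'M[R]_n) : smoother A -> smoother (1%:M - A).
Proof.
move=> [AT Av]; split=> [|v]; first by rewrite linearB/= trmx1 AT.
have := Av v; rewrite !mulmxBl !mul1mx !dotDl !dotDr !dotNl !dotNr [dot (A *m v) v]dotC.
lra.
Qed.

Lemma smoother_le1 n (A : 'M[R]_n) v : smoother A -> dot v (A *m v) <= dot v v.
Proof.
move=> /smoother_compl/(smoother_ge0 v).
by rewrite mulmxBl mul1mx dotDr dotNr subr_ge0.
Qed.

End smoothers.

Section penalized_least_squares.
Context {R : realType}.

Lemma mulmx_ext0 m n (M : 'M[R]_(m, n)) : (forall u : 'cV_n, M *m u = 0) -> M = 0.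
Proof.
move=> M0; apply/matrixP => i j; have := M0 (delta_mx j 0).
by rewrite -colE => /colP/(_ i); rewrite !mxE.
Qed.

Lemma penrose_tr m n (C : 'M[R]_(m, n)) G : penrose C G -> penrose C^T G^T.
Proof.
move=> [a b c d]; split.
- by rewrite -!trmx_mul mulmxA a.
- by rewrite -!trmx_mul mulmxA b.
- by rewrite -!trmx_mul d.
- by rewrite -!trmx_mul c.
Qed.

Lemma mpinv_sym n (C : 'M[R]_n) : C^T = C -> (mpinv C)^T = mpinv C.
Proof.
move=> CT; apply: penrose_uniq (mpinvP C).
by have := penrose_tr (mpinvP C); rewrite CT.
Qed.

Variables (n q : nat) (F : 'M[R]_(n, q)) (S : 'M[R]_q).
Hypothesis S_nonneg : nonnegdef S.

Notation T := (F^T *m F + S).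
Notation G := (mpinv T).
Notation A := (F *m G *m F^T).

Let T_sym : T^T = T.
Proof. by rewrite linearD/= trmx_mul trmxK S_nonneg.1. Qed.

Lemma pls_sym : A^T = A.
Proof. by rewrite !trmx_mul trmxK mpinv_sym// mulmxA. Qed.

(** [T] is a sum of nonnegative definite matrices, so its kernel lies in that of
    [F]; and [1 - G T] takes its values in the kernel of [T]. *)
Lemma pls_fit : F *m G *m T = F.
Proof.
have [TGT _ _ _] := mpinvP T.
suff: F *m (1%:M - G *m T) = 0.
  by rewrite mulmxBr mulmx1 mulmxA => /eqP; rewrite subr_eq0 => /eqP <-.
apply: mulmx_ext0 => u; rewrite -mulmxA; set v := _ *m u.
have Tv : T *m v = 0.
  by rewrite /v mulmxA mulmxBr mulmx1 mulmxA TGT subrr mul0mx.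
have : dot v (T *m v) = 0 by rewrite Tv dot0r.
rewrite mulmxDl dotDr -mulmxA -dot_mulmx => Fv0.
have Sv : 0 <= dot v (S *m v) by rewrite -bilinE; exact: S_nonneg.2.
by have := dot_ge0 (F *m v) => Fv1; apply: dot_eq0; lra.
Qed.

(** The difference of [A] and [A ^ 2] is [F G S (F G)^T], which is nonnegative
    definite. *)
Lemma pls_contraction v : dot (A *m v) (A *m v) <= dot v (A *m v).
Proof.
have AS : A - A *m A = (F *m G) *m S *m (F *m G)^T.
  have GT : (F *m G)^T = G *m F^T by rewrite trmx_mul mpinv_sym.
  have FGS : F *m G *m S = F - F *m G *m (F^T *m F).
    apply/eqP; rewrite eq_sym subr_eq -mulmxDr [S + _]addrC.
    by rewrite pls_fit.
  by rewrite FGS GT mulmxBl !mulmxA.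
rewrite dot_mulmx pls_sym -subr_ge0 -dotNr -dotDr mulmxA -mulmxBl AS.
have := S_nonneg.2 ((F *m G)^T *m v).
by rewrite -/(bilin _ _ _) bilinE dot_mulmx trmxK !mulmxA.
Qed.

Lemma pls_smoother : smoother A.
Proof. by split; [exact: pls_sym|exact: pls_contraction]. Qed.

End penalized_least_squares.

Section positive_definite.
Context {R : realType}.

Lemma posdef_nonneg k (W : 'M[R]_k) : posdef W -> nonnegdef W.
Proof.
move=> [WT W0]; split=> // u; have [->|u0] := eqVneq u 0; last exact: ltW (W0 u u0).
by rewrite mulmx0 mxE.
Qed.

Lemma posdef_unit k (W : 'M[R]_k) : posdef W -> W \in unitmx.
Proof.
move=> [WT W0]; rewrite -row_free_unit; apply: inj_row_free => v vW0.
have [//|v0] := eqVneq v 0.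
have vT0 : v^T != 0 by rewrite -(inj_eq (can_inj (@trmxK _ _ _))) trmxK trmx0.
by have := W0 _ vT0; rewrite trmxK vW0 mul0mx mxE ltxx.
Qed.

End positive_definite.

Section mixed_smoother.
Context {R : realType}.
Variables (n p q : nat) (F : 'M[R]_(n, q)) (Q : 'M[R]_q) (lambda : R).
Variables (Z : 'M[R]_(n, p)) (Sigma : 'M[R]_p).
Hypotheses (Q_nonneg : nonnegdef Q) (lambda_gt0 : 0 < lambda).
Hypothesis Sigma_pos : posdef Sigma.

Let At := fixed_smoothing_mx F Q lambda.
Let A := smoothing_mx F Q lambda Z Sigma.
Let M := row_mx F Z.
Let S1 := (n%:R * lambda) *: Q.
Let S2 : 'M[R]_(q + p) := block_mx S1 0 0 Sigma.

Let S1_nonneg : nonnegdef S1.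
Proof.
split=> [|u]; first by rewrite linearZ/= Q_nonneg.1.
rewrite -/(bilin _ u u) bilinE -scalemxAl dotZr mulr_ge0//.
  by rewrite mulr_ge0// ltW.
by rewrite -bilinE; exact: Q_nonneg.2.
Qed.

Let S2_nonneg : nonnegdef S2.
Proof.
split=> [|u].
  by rewrite tr_block_mx !trmx0 S1_nonneg.1 Sigma_pos.1.
rewrite -[u]vsubmxK tr_col_mx mul_row_block !mulmx0 addr0 add0r mul_row_col mxE.
by rewrite addr_ge0// ?S1_nonneg.2// (posdef_nonneg Sigma_pos).2.
Qed.

Let normalE : normal_eq_mx F Q lambda Z Sigma = M^T *m M + S2.
Proof.
by rewrite /normal_eq_mx /M tr_row_mx mul_col_row add_block_mx !addr0.
Qed.

Let AE : A = M *m mpinv (M^T *m M + S2) *m M^T.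
Proof. by rewrite /A /smoothing_mx normalE /M tr_row_mx. Qed.

Lemma smoothing_mx_smoother : smoother A.
Proof. by rewrite AE; exact: pls_smoother. Qed.

Let At_smoother : smoother At.
Proof. exact: pls_smoother. Qed.

Let C := Z^T *m (1%:M - At) *m Z.

Let dot_CE u : dot u (C *m u) = dot (Z *m u) ((1%:M - At) *m (Z *m u)).
Proof. by rewrite dot_mulmx /C !mulmxA. Qed.

Let W_pos : posdef (C + Sigma).
Proof.
split=> [|u u0].
  by rewrite linearD/= Sigma_pos.1 /C !trmx_mul trmxK linearB/= trmx1 At_smoother.1 mulmxA.
rewrite -/(bilin _ u u) bilinE mulmxDl dotDr ltr_wpDl//; last first.
  by rewrite -bilinE; exact: Sigma_pos.2.
by rewrite dot_CE smoother_ge0//; exact: smoother_compl.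
Qed.

(** Let [(c, b)] solve the normal equations for the data [Z v], and [u = v - b].
    The first block of equations says that [F c] is the fixed-effects fit to
    [Z u], so the residual is [(1 - At) Z u]; the second one then reads
    [(C + Sigma) u = Sigma v]. The squared residual is at most [u^T C u], hence at
    most [u^T (C + Sigma) u], which is the right-hand side. *)
Lemma residual_random_effects (v : 'cV[R]_p) :
  dot ((1%:M - A) *m Z *m v) ((1%:M - A) *m Z *m v) <=
  dot v (Sigma *m invmx (C + Sigma) *m Sigma *m v).
Proof.
have WU := posdef_unit W_pos.
have fit : M *m mpinv (M^T *m M + S2) *m (M^T *m M + S2) = M by exact: pls_fit.
have nT : (M^T *m M + S2)^T = M^T *m M + S2.
  by rewrite linearD/= trmx_mul trmxK S2_nonneg.1.
have fitT : (M^T *m M + S2) *m (mpinv (M^T *m M + S2) *m M^T) = M^T.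
  by rewrite -[RHS](congr1 trmx fit) trmx_mul nT trmx_mul mpinv_sym.
pose s := mpinv (M^T *m M + S2) *m M^T *m (Z *m v).
have As : A *m (Z *m v) = M *m s by rewrite AE /s !mulmxA.
have Ns : (M^T *m M + S2) *m s = M^T *m (Z *m v) by rewrite /s mulmxA fitT.
pose c := usubmx s; pose b := dsubmx s.
have sE : s = col_mx c b by rewrite vsubmxK.
have MsE : M *m s = F *m c + Z *m b by rewrite sE mul_row_col.
have [E1 E2] : F^T *m (F *m c + Z *m b) + S1 *m c = F^T *m (Z *m v) /\
               Z^T *m (F *m c + Z *m b) + Sigma *m b = Z^T *m (Z *m v).
  move: Ns; rewrite mulmxDl -mulmxA MsE sE /M tr_row_mx !mul_col_mx.
  rewrite !mul_row_col !mul0mx addr0 add0r add_col_mx.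
  by move/eq_col_mx.
pose u := v - b.
have T1 : (F^T *m F + S1) *m c = F^T *m (Z *m u).
  by rewrite /u !mulmxBr -E1 mulmxDr mulmxDl -mulmxA [RHS]addrAC addrK.
have Fc : F *m c = At *m (Z *m u).
  rewrite /At /fixed_smoothing_mx -(mulmxA _ F^T) -T1 !mulmxA.
  by rewrite pls_fit.
have res : (1%:M - A) *m Z *m v = (1%:M - At) *m (Z *m u).
  rewrite -mulmxA mulmxBl mul1mx As MsE Fc mulmxBl mul1mx /u mulmxBr.
  by rewrite opprD addrA addrAC.
have Cu : (C + Sigma) *m u = Sigma *m v.
  have E3 : Z^T *m ((1%:M - At) *m (Z *m u)) = Sigma *m b.
    rewrite -res -mulmxA mulmxBl mul1mx As MsE mulmxBr -E2.
    by rewrite addrC addKr.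
  by rewrite mulmxDl /C -!mulmxA E3 -mulmxDr /u addrC subrK.
have uE : u = invmx (C + Sigma) *m (Sigma *m v).
  by rewrite -Cu mulKmx.
rewrite res.
have [_ co] := smoother_compl At_smoother.
apply: (le_trans (co _)); rewrite -dot_CE.
apply: (@le_trans _ _ (dot u ((C + Sigma) *m u))).
  by rewrite mulmxDl dotDr lerDl -bilinE; exact: (posdef_nonneg Sigma_pos).2.
rewrite Cu dotC dot_mulmx Sigma_pos.1 uE !mulmxA//.
Qed.

Lemma profile_mx_sym :
  (Sigma *m invmx (C + Sigma) *m Sigma)^T = Sigma *m invmx (C + Sigma) *m Sigma.
Proof. by rewrite !trmx_mul trmx_inv W_pos.1 Sigma_pos.1 mulmxA. Qed.

End mixed_smoother.

Section penalty.
Context {R : realType}.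

Lemma penalty_mx_nonneg (X : Type) (H : set (X -> R)) J q (xi : 'I_q -> X -> R) :
  semi_inner_product_on H J -> (forall j, H (xi j)) -> nonnegdef (penalty_mx J xi).
Proof.
move=> [H0 HP sym lin ge0] Hxi.
have Jl0 h : H h -> J (fun=> 0) h = 0.
  move=> Hh; have := lin (-1) _ _ h H0 H0 Hh.
  have -> : (fun t : X => -1 * 0 + 0) = (fun=> 0 : R).
    by apply/funext => t; rewrite mulr0 addr0.
  by rewrite mulN1r addNr.
split=> [|u]; first by apply/matrixP => i j; rewrite !mxE sym.
pose f (r : seq 'I_q) (t : X) := \sum_(i <- r) u i 0 * xi i t.
have fcons i r : f (i :: r) = (fun t => u i 0 * xi i t + f r t).
  by apply/funext => t; rewrite /f big_cons.
have fnil : f [::] = (fun=> 0) by apply/funext => t; rewrite /f big_nil.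
have Hf r : H (f r).
  by elim: r => [|i r IH]; [rewrite fnil|rewrite fcons; exact: HP].
have Jf r h : H h -> J (f r) h = \sum_(i <- r) u i 0 * J (xi i) h.
  move=> Hh; elim: r => [|i r IH]; first by rewrite fnil big_nil Jl0.
  by rewrite fcons big_cons lin// IH.
have := ge0 _ (Hf (index_enum 'I_q)).
rewrite Jf// -/(bilin _ u u) bilinE dotE; congr (_ <= _).
apply: eq_bigr => i _; congr (_ * _); rewrite sym// Jf// mxE.
by apply: eq_bigr => j _; rewrite mxE mulrC sym.
Qed.

End penalty.

(** * Quadratic forms in a vector with Gaussian moments of order four *)

Lemma trace_mulmx_tr (R : realType) m n (A B : 'M[R]_(m, n)) :
  \tr (A *m B^T) = \sum_i \sum_j A i j * B i j.
Proof.
by apply: eq_bigr => i _; rewrite mxE; apply: eq_bigr => j _; rewrite mxE.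
Qed.

Section gaussian_vector.
Context {d : measure_display} {T : measurableType d} {R : realType}.
Variables (P : probability T R) (N : nat) (C : 'M[R]_N) (zeta : T -> 'cV[R]_N).

(** Joint normality, up to the fourth moments. *)
Definition gauss4_vec : Prop := C^T = C /\
  forall u : 'cV[R]_N, gauss4 P (fun w => dot u (zeta w)) (dot u (C *m u)).

Hypothesis zetaG : gauss4_vec.

Notation q u v := (dot u (C *m v)).

Let qC u v : q u v = q v u.
Proof. by rewrite dotC dot_mulmx zetaG.1. Qed.

Let qDr u v w : q u (v + w) = q u v + q u w.
Proof. by rewrite mulmxDr dotDr. Qed.

Let qZr u a v : q u (a *: v) = a * q u v.
Proof. by rewrite -scalemxAr dotZr. Qed.

Lemma covariance_linear u v :
  has_mean P (fun w => dot u (zeta w) * dot v (zeta w)) (q u v).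
Proof.
have [_ _ S _] := zetaG.2 (u + v); have [_ _ D _] := zetaG.2 (u + (-1) *: v).
apply: eq_has_mean (has_meanZ 4^-1 (has_meanD S (has_meanZ (-1) D))) => [w|].
  by rewrite !dotDl !dotZl; field.
by rewrite !qDr !qZr !dotDl !dotZl (qC v u); field.
Qed.

(** Polarization: the product of four linear forms is a combination of fourth
    powers of their eight signed sums, and the fourth moment of each of these
    is three times the square of its variance. *)
Lemma isserlis u v s t :
  has_mean P (fun w => dot u (zeta w) * dot v (zeta w) *
                       (dot s (zeta w) * dot t (zeta w)))
    (q u v * q s t + q u s * q v t + q u t * q v s).
Proof.
(* q (e a b c) (e a b c) is the variance of the signed sum of the four forms. *)
pose e a b c := u + a *: v + b *: s + c *: t.
have E a b c : q (e a b c) (e a b c) =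
    q u u + a ^+ 2 * q v v + b ^+ 2 * q s s + c ^+ 2 * q t t +
    2 * (a * q u v + b * q u s + c * q u t + a * b * q v s + a * c * q v t
         + b * c * q s t).
  rewrite /e !qDr !qZr !dotDl !dotZl (qC v u) (qC s u) (qC t u) (qC s v) (qC t v) (qC t s).
  ring.
have H a b c : has_mean P (fun w => (dot u (zeta w) + a * dot v (zeta w) +
    b * dot s (zeta w) + c * dot t (zeta w)) ^+ 4) (3 * q (e a b c) (e a b c) ^+ 2).
  have [_ _ _ h] := zetaG.2 (e a b c).
  by apply: eq_has_mean h => [w|//]; rewrite /e !dotDl !dotZl.
pose D := has_meanD; pose Z f a (h : has_mean P f a) := has_meanZ (-1) h.
(* 192 = 8 * 4!: the product of the four forms has coefficient 4! in each of
   the eight fourth powers. *)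
apply: eq_has_mean (has_meanZ 192^-1
  (D _ _ _ _ _ _ _ _ (D _ _ _ _ _ _ _ _ (D _ _ _ _ _ _ _ _ (H 1 1 1) (H 1 (-1) (-1)))
     (D _ _ _ _ _ _ _ _ (H (-1) 1 (-1)) (H (-1) (-1) 1)))
     (Z _ _ (D _ _ _ _ _ _ _ _ (D _ _ _ _ _ _ _ _ (H (-1) (-1) (-1)) (H (-1) 1 1))
     (D _ _ _ _ _ _ _ _ (H 1 (-1) 1) (H 1 1 (-1))))))) => [w|].
  by field.
by rewrite !E; field.
Qed.

Lemma quadE (M : 'M[R]_N) (z : 'cV[R]_N) :
  dot z (M *m z) = \sum_i \sum_j M i j * (z i 0 * z j 0).
Proof.
rewrite dotE; apply: eq_bigr => i _; rewrite mxE mulr_sumr.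
by apply: eq_bigr => j _; ring.
Qed.

Let q_delta i j : q (delta_mx i 0) (delta_mx j 0) = C i j.
Proof. by rewrite dot_delta_mx -colE mxE. Qed.

Let coordE i w : dot (delta_mx i 0) (zeta w) = zeta w i 0.
Proof. exact: dot_delta_mx. Qed.

Lemma mean_quad (M : 'M[R]_N) :
  has_mean P (fun w => dot (zeta w) (M *m zeta w)) (\tr (M *m C)).
Proof.
rewrite -[X in _ *m X]zetaG.1 trace_mulmx_tr.
apply: (@eq_has_mean _ _ _ _ (fun w => \sum_i \sum_j M i j * (zeta w i 0 * zeta w j 0))).
- by move=> w; rewrite quadE.
- by [].
apply: has_mean_sum => i _; apply: has_mean_sum => j _; apply: has_meanZ.
have := covariance_linear (delta_mx i 0) (delta_mx j 0).
by apply: eq_has_mean => [w|]; rewrite ?coordE ?q_delta.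
Qed.

Let congE (M A B : 'M[R]_N) i j :
  (A *m M *m B) i j = \sum_k \sum_l M k l * (A i k * B l j).
Proof.
rewrite -mulmxA mxE; apply: eq_bigr => k _; rewrite mxE mulr_sumr.
by apply: eq_bigr => l _; ring.
Qed.

Lemma mean_quad_sqr (M : 'M[R]_N) :
  has_mean P (fun w => dot (zeta w) (M *m zeta w) ^+ 2)
    (\tr (M *m C) ^+ 2 + \tr (M *m C *m M^T *m C) + \tr (M *m C *m M *m C)).
Proof.
apply: (@eq_has_mean _ _ _ _ (fun w => \sum_i \sum_j M i j *
   \sum_k \sum_l M k l * (zeta w i 0 * zeta w j 0 * (zeta w k 0 * zeta w l 0))) _
  (\sum_i \sum_j M i j *
   \sum_k \sum_l M k l * (C i j * C k l + C i k * C j l + C i l * C j k))).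
- move=> w; rewrite expr2 quadE mulr_suml; apply: eq_bigr => i _.
  rewrite mulr_suml; apply: eq_bigr => j _; rewrite -mulrA; congr (_ * _).
  rewrite mulr_sumr; apply: eq_bigr => k _; rewrite mulr_sumr.
  by apply: eq_bigr => l _; ring.
- have T1 : \tr (M *m C) = \sum_i \sum_j M i j * C i j.
    by rewrite -[X in _ *m X]zetaG.1 trace_mulmx_tr.
  have T2 : \tr (M *m C *m M^T *m C) = \sum_i \sum_j M i j * (C *m M *m C) i j.
    rewrite -trace_mulmx_tr !trmx_mul zetaG.1; by rewrite !mulmxA.
  have T3 : \tr (M *m C *m M *m C) = \sum_i \sum_j M i j * (C *m M^T *m C) i j.
    rewrite -trace_mulmx_tr !trmx_mul trmxK zetaG.1; by rewrite !mulmxA.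
  rewrite T2 T3 expr2 {1}T1 mulr_suml -!big_split/=; apply: eq_bigr => i _.
  rewrite mulr_suml -!big_split/=; apply: eq_bigr => j _.
  rewrite -mulrA -!mulrDr; congr (_ * _).
  rewrite !congE T1 mulr_sumr exchange_big/= [X in _ = _ + X]exchange_big/=.
  rewrite [X in X = _]exchange_big/=.
  rewrite -!big_split/=; apply: eq_bigr => k _.
  rewrite mulr_sumr -!big_split/=; apply: eq_bigr => l _.
  have CE a c : C a c = C c a by rewrite -{1}zetaG.1 mxE.
  by rewrite [M^T _ _]mxE (CE l j) (CE k j); ring.
apply: has_mean_sum => i _; apply: has_mean_sum => j _; apply: has_meanZ.
apply: has_mean_sum => k _; apply: has_mean_sum => l _; apply: has_meanZ.
have := isserlis (delta_mx i 0) (delta_mx j 0) (delta_mx k 0) (delta_mx l 0).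
by apply: eq_has_mean => [w|]; rewrite ?coordE ?q_delta.
Qed.

End gaussian_vector.

Section second_moments.
Context {d : measure_display} {T : measurableType d} {R : realType}.
Variable P : probability T R.

(** An upper bound is all that Chebyshev's inequality asks for, and it spares the
    exact value of mixed third moments. *)
Definition second_moment_le (f : T -> R) (k : R) : Prop :=
  measurable_fun setT f /\ exists2 m, m <= k & has_mean P (fun w => f w ^+ 2) m.

Lemma second_moment_le_dom (f g : T -> R) k : measurable_fun setT f ->
  (forall w, f w ^+ 2 <= g w) -> has_mean P g k -> second_moment_le f k.
Proof.
move=> mf fg gk; split=> //.
have mf2 : measurable_fun setT (fun w => f w ^+ 2) by exact: measurable_funX.
have [|m fm] := @integrable_has_mean _ _ _ P (fun w => f w ^+ 2).
  apply: integrable_le mf2 _ gk => w; rewrite ger0_norm ?sqr_ge0//.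
exists m => //; rewrite -lee_fin -fm.2 -gk.2.
apply: ge0_le_integral => //=.
- by move=> w _; rewrite lee_fin sqr_ge0.
- exact/measurable_EFinP.
- by apply/measurable_EFinP; exact: has_mean_measurable gk.
- by move=> w _; rewrite lee_fin.
Qed.

Lemma second_moment_le_weaken (f : T -> R) k k' : k <= k' ->
  second_moment_le f k -> second_moment_le f k'.
Proof. by move=> kk' [mf [m mk fm]]; split=> //; exists m => //; exact: le_trans kk'. Qed.

Lemma second_moment_leZ (f : T -> R) c k :
  second_moment_le f k -> second_moment_le (fun w => c * f w) (c ^+ 2 * k).
Proof.
move=> [mf [m mk fm]]; split; first exact: measurable_funM.
exists (c ^+ 2 * m); first by rewrite ler_wpM2l ?sqr_ge0.
by apply: eq_has_mean (has_meanZ (c ^+ 2) fm) => // w; rewrite exprMn.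
Qed.

Lemma Chebyshev_le (f : T -> R) (k a : R) : 0 < a -> second_moment_le f k ->
  (P [set w | (a < `|f w|)%R] <= (k / a ^+ 2)%:E)%E.
Proof.
move=> a0 [mf [m mk fm]]; set S := [set w | _].
have mS : measurable S by exact: measurable_lt_norm.
have a2 : 0 < a ^+ 2 by rewrite exprn_gt0.
rewrite -(@lee_pmul2l _ (a ^+ 2)%:E)// -EFinM.
rewrite mulrC divfK ?gt_eqF//.
apply: (@le_trans _ _ m%:E); last by rewrite lee_fin.
rewrite -fm.2 -[P S](_ : (\int[P]_w (\1_S w)%:E)%E = _); last first.
  by rewrite integral_indic ?setIT.
rewrite -ge0_integralZl//; [|exact/measurable_EFinP|by rewrite lee_fin ltW].
apply: ge0_le_integral => //=.
- by move=> w _; rewrite lee_fin mulr_ge0// ltW.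
- by apply/measurable_EFinP/measurable_funM => //; exact: measurable_indic.
- by apply/measurable_EFinP; exact: has_mean_measurable fm.
- move=> w _; rewrite lee_fin indicE; case: (boolP (w \in S)) => [|_].
    rewrite inE /S/= mulr1 => aw.
    by rewrite -[leRHS]real_normK ?num_real// ler_pXn2r// ?nnegrE// ltW.
  by rewrite mulr0 sqr_ge0.
Qed.

Variables (N : nat) (C : 'M[R]_N) (zeta : T -> 'cV[R]_N).
Hypothesis zetaG : gauss4_vec P C zeta.

(** The linear part and the centered quadratic part are uncorrelated for
    Gaussian vectors, but [(x + y) ^ 2 <= 2 x ^ 2 + 2 y ^ 2] avoids third moments
    at the cost of a factor two. *)
Lemma second_moment_chaos (l : 'cV[R]_N) (M : 'M[R]_N) :
  second_moment_le
    (fun w => dot l (zeta w) + (dot (zeta w) (M *m zeta w) - \tr (M *m C)))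
    (2 * dot l (C *m l) +
     2 * (\tr (M *m C *m M^T *m C) + \tr (M *m C *m M *m C))).
Proof.
have L := (gauss4_sqr (zetaG.2 l)); have mL := gauss4_meas (zetaG.2 l).
have Q1 := mean_quad zetaG M; have Q2 := mean_quad_sqr zetaG M.
set t := \tr (M *m C) in Q1 Q2 *.
have mQ := has_mean_measurable Q1.
have Qc : has_mean P (fun w => (dot (zeta w) (M *m zeta w) - t) ^+ 2)
    (\tr (M *m C *m M^T *m C) + \tr (M *m C *m M *m C)).
  apply: eq_has_mean (has_meanD Q2 (has_meanD (has_meanZ (-2 * t) Q1)
    (has_mean_cst P (t ^+ 2)))) => [w|]; ring.
apply: second_moment_le_dom (has_meanD (has_meanZ 2 L) (has_meanZ 2 Qc)).
  by apply: measurable_funD => //; exact: measurable_funB.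
move=> w; set x := dot l _; set y := _ - t.
by have := sqr_ge0 (x - y); nra.
Qed.

End second_moments.

(** * The algebra of the cross-validation score *)

Section deterministic.
Context {R : realType}.

(** [m] stands for the number of observations, [W] and [rho] for [m] times the
    loss and the risk, [v] for the squared norm of the errors, and [c], [a], [e] for the three centered
    error terms. Put [g = (1 - mu) ^ -2 - 1], which is [2 mu + O(mu ^ 2)]. The gap is
    [(1 + g) (2 c - 2 a) + g W + g e + m s2 ((g - 2 mu) - 2 g mu)]: at order
    [m mu], the inflation of the residual sum of squares by the denominator
    offsets its bias, and the last term is of order [m mu ^ 2]. *)
Lemma gcv_loss_gap_le (m mu W v a c e s2 rho del e0 : R) :
  0 < e0 -> 0 < rho -> 0 < s2 -> 0 <= m ->
  0 <= mu -> mu <= del -> del <= 2^-1 -> del <= e0 / 128 ->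
  s2 * (m * mu ^+ 2) <= del * rho ->
  `|W - rho| <= rho / 2 -> `|c| <= e0 / 68 * rho -> `|a| <= e0 / 68 * rho ->
  `|8 * mu * e| <= e0 / 68 * rho -> v = e + m * s2 ->
  `|(W + v + 2 * c - 2 * (a + s2 * (m * mu))) / (1 - mu) ^+ 2 - W - v| <= e0 * W.
Proof.
move=> e00 rho0 s20 m0 mu0 mud d2 de hmu.
rewrite ler_norml => /andP[W1 W2]; rewrite ler_norml => /andP[c1 c2].
rewrite ler_norml => /andP[a1 a2]; rewrite ler_norml => /andP[e1 e2] ->.
have mu2 : mu <= 2^-1 by apply: le_trans d2.
have um : 0 < 1 - mu by lra.
pose g := ((1 - mu) ^+ 2)^-1 - 1.
have u2 : (1 - mu) ^+ 2 * (1 + g) = 1.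
  by rewrite /g; field; rewrite gt_eqF.
have tE : (1 - mu) ^+ 2 = 1 - 2 * mu + mu ^+ 2 by ring.
have t4 : 0 <= (1 - mu) ^+ 2 - 4^-1.
  by have := mulr_ge0 (_ : 0 <= 2^-1 - mu) (_ : 0 <= 3 / 2 - mu); lra.
have t2 : 0 < (1 - mu) ^+ 2 by rewrite exprn_gt0.
have gt : (1 - mu) ^+ 2 * g = mu * (2 - mu).
  by have : (1 - mu) ^+ 2 * (1 + g) - (1 - mu) ^+ 2 = mu * (2 - mu); [rewrite u2|]; lra.
have g0 : 0 <= g by rewrite -(pmulr_rge0 _ t2) gt mulr_ge0//; lra.
have g3 : g <= 3.
  by have := mulr_ge0 t4 (_ : 0 <= 1 + g); rewrite mulrBl u2; lra.
have g8 : g <= 8 * mu.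
  by have := mulr_ge0 t4 g0; rewrite mulrBl gt; have := sqr_ge0 mu; lra.
have muX : 0 <= mu ^+ 2 by exact: sqr_ge0.
have muX3 : 0 <= mu ^+ 2 * (2^-1 - mu) by rewrite mulr_ge0// subr_ge0.
have gE : (1 - mu) ^+ 2 * (g - 2 * mu) = 3 * mu ^+ 2 - 2 * (mu ^+ 2 * mu).
  have -> : (1 - mu) ^+ 2 * (g - 2 * mu) =
    (1 - mu) ^+ 2 * (1 + g) - (1 - mu) ^+ 2 * (1 + 2 * mu) by ring.
  by rewrite u2; ring.
have gm1 : 0 <= g - 2 * mu by rewrite -(pmulr_rge0 _ t2) gE; lra.
have gm2 : g - 2 * mu <= 12 * mu ^+ 2.
  have := mulr_ge0 t4 gm1.
  by rewrite mulrBl gE; have := mulr_ge0 muX mu0; lra.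
have -> : (W + (e + m * s2) + 2 * c - 2 * (a + s2 * (m * mu))) / (1 - mu) ^+ 2
    - W - (e + m * s2) = (1 + g) * (2 * c - 2 * a) + g * W + g * e +
    m * s2 * ((g - 2 * mu) - 2 * (g * mu)).
  have -> : ((1 - mu) ^+ 2)^-1 = 1 + g by rewrite /g; ring.
  ring.
have ca : `|2 * c - 2 * a| <= 4 * (e0 / 68 * rho).
  by rewrite ler_norml; apply/andP; split; lra.
have h1 : `|(1 + g) * (2 * c - 2 * a)| <= 16 * (e0 / 68 * rho).
  have g10 : 0 <= 1 + g by rewrite addr_ge0.
  have g14 : 1 + g <= 4 by lra.
  rewrite normrM (ger0_norm g10).
  have -> : 16 * (e0 / 68 * rho) = 4 * (4 * (e0 / 68 * rho)) by ring.
  exact: ler_pM.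
have W0 : 0 <= W by lra.
have h2 : `|g * W| <= 8 * del * W.
  rewrite ger0_norm ?mulr_ge0// ler_wpM2r// (le_trans g8)//; lra.
have h3 : `|g * e| <= e0 / 68 * rho.
  rewrite normrM ger0_norm//; apply: (@le_trans _ _ (8 * mu * `|e|)).
    by rewrite ler_wpM2r.
  rewrite -[8 * mu]ger0_norm ?mulr_ge0// -normrM ler_norml; apply/andP; split; lra.
have h4 : `|m * s2 * ((g - 2 * mu) - 2 * (g * mu))| <= 28 * (del * rho).
  have ms : 0 <= m * s2 by rewrite mulr_ge0// ltW.
  rewrite normrM ger0_norm//.
  apply: (@le_trans _ _ (m * s2 * (28 * mu ^+ 2))); last by lra.
  rewrite ler_wpM2l//.
  have gmu : g * mu <= 8 * mu ^+ 2 by rewrite expr2 mulrA ler_wpM2r.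
  have gmu0 : 0 <= g * mu by rewrite mulr_ge0.
  by rewrite ler_norml; apply/andP; split; lra.
have dr : del * rho <= e0 / 128 * rho by rewrite ler_wpM2r// ltW.
have dW : del * W <= e0 / 128 * W by rewrite ler_wpM2r.
have rW : e0 * rho <= 2 * (e0 * W).
  rewrite mulrCA ler_pM2l//; lra.
(* As rho <= 2 W, the total is (2 * 17 / 68 + 2 * 28 / 128 + 8 / 128) e0 W,
   which is e0 W: this is where 68 and 128 come from. *)
apply: (@le_trans _ _ (16 * (e0 / 68 * rho) + 8 * del * W + e0 / 68 * rho +
                       28 * (del * rho))).
  do 3 (apply: (le_trans (ler_normD _ _)); apply: lerD; last by []).
  exact: h1.
clear -dr dW rW.
lra.
Qed.

End deterministic.

(** * The mixed-effects model for a fixed number of observations *)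

Section traces.
Context {R : realType}.

Lemma ge0_trace n (S : 'M[R]_n) : (forall v, 0 <= dot v (S *m v)) -> 0 <= \tr S.
Proof. by move=> S0; apply: sumr_ge0 => i _; rewrite -dot_mx_delta. Qed.

Lemma le_trace n (S S' : 'M[R]_n) :
  (forall v, dot v (S *m v) <= dot v (S' *m v)) -> \tr S <= \tr S'.
Proof.
move=> SS; rewrite -subr_ge0 -raddfB; apply: ge0_trace => v.
by rewrite mulmxBl dotDr dotNr subr_ge0.
Qed.

End traces.

Lemma dot_col_mx (R : realType) m1 m2 (u1 v1 : 'cV[R]_m1) (u2 v2 : 'cV[R]_m2) :
  dot (col_mx u1 u2) (col_mx v1 v2) = dot u1 v1 + dot u2 v2.
Proof. by rewrite /dot tr_col_mx mul_row_col mxE. Qed.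

Section model.
Context {d : measure_display} {T : measurableType d} {R : realType}.
Variables (P : probability T R) (p n : nat).
Variables (b : {RV P >-> p.-tuple R}) (eps : 'I_n -> {RV P >-> R}).
Variables (B : 'M[R]_p) (s2 : R).
Hypotheses (s2_gt0 : 0 < s2) (b_normal : centered_normal_rvec B b).
Hypothesis eps_normal : forall i, centered_normal_rv P s2 (eps i).
Hypothesis indep_b_eps : mutually_independent b eps.

Definition errors (w : T) : 'cV[R]_n := \col_i eps i w.
Definition noise (w : T) : 'cV[R]_(p + n) := col_mx (tuple_col (b w)) (errors w).
Definition noise_cov : 'M[R]_(p + n) := block_mx B 0 0 s2%:M.

Notation zeta := noise.
Notation C := noise_cov.

Lemma noise_covE u1 u2 : C *m col_mx u1 u2 = col_mx (B *m u1) (s2 *: u2) :> 'cV_(p + n).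
Proof.
by rewrite /noise_cov mul_block_col !mul0mx addr0 add0r mul_scalar_mx.
Qed.

Lemma noise_gauss4 : gauss4_vec P C zeta.
Proof.
split=> [|u].
  by rewrite /noise_cov tr_block_mx !trmx0 tr_scalar_mx b_normal.1.1.
rewrite -[u]vsubmxK noise_covE dot_col_mx dotZr -bilinE dotE.
have := gauss4_linear indep_b_eps (ltW s2_gt0) b_normal eps_normal
  (usubmx u) (dsubmx u).
rewrite (_ : (fun w => _) =
  (fun w => dot (col_mx (usubmx u) (dsubmx u)) (zeta w))); last first.
  apply/funext => w; rewrite dot_col_mx; congr (_ + _).
  by rewrite dotE; apply: eq_bigr => i _; congr (_ * _); rewrite mxE.
by [].
Qed.

(** The only nonzero block of [M] is [S], facing the errors. *)
Lemma second_moment_error_quad (S : 'M[R]_n) : S^T = S ->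
  second_moment_le P (fun w => dot (errors w) (S *m errors w) - s2 * \tr S)
    (4 * s2 ^+ 2 * \tr (S *m S)).
Proof.
move=> ST; pose M : 'M[R]_(p + n) := block_mx 0 0 0 S.
have MT : M^T = M by rewrite /M tr_block_mx !trmx0 ST.
have MC : M *m C = block_mx 0 0 0 (s2 *: S).
  by rewrite /M /noise_cov mulmx_block !(mulmx0, mul0mx, addr0, add0r) mul_mx_scalar.
have := second_moment_chaos noise_gauss4 0 M.
rewrite dotC dot0r MT -!mulmxA MC mulmxA MC mulmx_block.
rewrite !(mulmx0, mul0mx, addr0, add0r) -scalemxAl -scalemxAr scalerA.
rewrite !mxtrace_block !mxtrace0 !add0r !mxtraceZ mulr0 add0r.
rewrite (_ : (fun w => _) = (fun w => dot (errors w) (S *m errors w) - s2 * \tr S)).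
  apply: second_moment_le_weaken; rewrite le_eqVlt; apply/orP; left; apply/eqP; ring.
apply/funext => w; rewrite dotC dot0r add0r; congr (_ - _).
by rewrite /M /noise mul_block_col !mul0mx !add0r dot_col_mx dot0r add0r.
Qed.

Variables (A : 'M[R]_n) (Z : 'M[R]_(n, p)) (eta : 'cV[R]_n).
Variables (kB kZ : R).
Hypotheses (A_smoother : smoother A) (kB_ge0 : 0 <= kB) (kZ_ge0 : 0 <= kZ).
Hypothesis B_le : forall v, dot v (B *m v) <= kB * dot v v.
Notation G := ((1%:M - A) *m Z).
Hypothesis G_le : forall v, dot (G *m v) (G *m v) <= kZ * dot v v.

Notation w0 := ((1%:M - A) *m eta).
(** The covariance matrix of [(1 - A) Z b - A eps]. *)
Definition loss_cov : 'M[R]_n := G *m B *m G^T + s2 *: (A *m A).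
Definition nloss (w : T) : R :=
  let v := w0 + (G *m tuple_col (b w) - A *m errors w) in dot v v.
Definition nrisk : R := dot w0 w0 + \tr loss_cov.

Notation H := loss_cov.
Let D : 'M[R]_(n, p + n) := row_mx G (- A).

Let AT : A^T = A. Proof. exact: A_smoother.1. Qed.

Let DCD : D *m C *m D^T = H.
Proof.
rewrite /D /noise_cov mul_row_block !mulmx0 addr0 add0r tr_row_mx mul_row_col.
by rewrite linearN/= AT mulmxN !mulNmx opprK mul_mx_scalar -scalemxAl.
Qed.

Let nlossE w : nloss w = dot (w0 + D *m zeta w) (w0 + D *m zeta w).
Proof. by rewrite /nloss /D mul_row_col mulNmx. Qed.

Let HT : H^T = H.
Proof.
by rewrite -DCD !trmx_mul trmxK (noise_gauss4).1 mulmxA.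
Qed.

Let AA_ge0 v : 0 <= dot v (A *m A *m v).
Proof. by rewrite -mulmxA -{1}AT -dot_mulmx dot_ge0. Qed.

Let GBG_ge0 v : 0 <= dot v (G *m B *m G^T *m v).
Proof.
rewrite -!mulmxA [X in dot v X]mulmxA -{1}[G]trmxK -dot_mulmx.
by rewrite -bilinE; exact: b_normal.1.2.
Qed.

Let H_nonneg : nonnegdef H.
Proof.
split; first exact: HT.
move=> u; rewrite -/(bilin _ u u) bilinE mulmxDl dotDr addr_ge0//.
by rewrite -scalemxAl dotZr mulr_ge0// ltW.
Qed.

Let kappa := kB * kZ + s2.

Let kappa_ge0 : 0 <= kappa.
Proof. by rewrite addr_ge0 ?mulr_ge0// (ltW s2_gt0). Qed.

Let H_le v : dot v (H *m v) <= kappa * dot v v.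
Proof.
rewrite mulmxDl dotDr mulrDl lerD//.
  rewrite -mulmxA -mulmxA -{1}[G]trmxK -dot_mulmx (le_trans (B_le _))//.
  by rewrite -mulrA ler_wpM2l//; exact: operator_bound_tr.
rewrite -scalemxAl dotZr ler_wpM2l//; first exact: ltW.
rewrite -mulmxA -{1}AT -dot_mulmx (le_trans (A_smoother.2 v))//.
exact: smoother_le1.
Qed.

Let trHH : \tr (H *m H) <= kappa * \tr H.
Proof.
rewrite -mxtraceZ; apply: le_trace => v.
rewrite -mulmxA -{1}HT -dot_mulmx -scalemxAl dotZr.
exact: nonnegdef_sqr_le.
Qed.

Let trH_ge0 : 0 <= \tr H.
Proof. by apply: ge0_trace => v; rewrite -bilinE; exact: H_nonneg.2. Qed.

Let trGBG_ge0 : 0 <= \tr (G *m B *m G^T).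
Proof. exact: ge0_trace. Qed.

Let trAA_ge0 : 0 <= \tr (A *m A).
Proof. exact: ge0_trace. Qed.

Let trDDC : \tr (D^T *m D *m C) = \tr H.
Proof. by rewrite -mulmxA mxtrace_mulC DCD. Qed.

Let nloss_decomp w : nloss w - nrisk = dot (2 *: (D^T *m w0)) (zeta w) +
   (dot (zeta w) (D^T *m D *m zeta w) - \tr (D^T *m D *m C)).
Proof.
have E : dot (D^T *m w0) (zeta w) = dot w0 (D *m zeta w).
  by rewrite dot_mulmx trmxK.
have E' : dot (zeta w) (D^T *m D *m zeta w) = dot (D *m zeta w) (D *m zeta w).
  by rewrite [RHS]dot_mulmx mulmxA.
rewrite nlossE /nrisk trDDC dotZl E E' !dotDl !dotDr [dot (D *m _) w0]dotC.
ring.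
Qed.

Lemma nloss_mean : has_mean P nloss nrisk.
Proof.
have L := gauss4_mean (noise_gauss4.2 (2 *: (D^T *m w0))).
have Qd := mean_quad noise_gauss4 (D^T *m D).
apply: eq_has_mean (has_meanD L (has_meanD Qd
  (has_mean_cst P (nrisk - \tr (D^T *m D *m C))))) => [w|]; last by ring.
by have := nloss_decomp w; lra.
Qed.

(** [nloss] is the squared norm of [w0 + D zeta] with [D = ((1 - A) Z, - A)], so its
    variance is governed by the largest eigenvalue of the covariance matrix
    [H = D C D^T] of [D zeta], which is at most [kappa]. *)
Lemma nloss_concentration :
  second_moment_le P (fun w => nloss w - nrisk) (8 * kappa * nrisk).
Proof.
have := second_moment_chaos noise_gauss4 (2 *: (D^T *m w0)) (D^T *m D).
under [X in second_moment_le _ X _]eq_fun do rewrite -nloss_decomp.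
apply: second_moment_le_weaken.
have -> : (D^T *m D)^T = D^T *m D by rewrite trmx_mul trmxK.
have -> : \tr (D^T *m D *m C *m (D^T *m D) *m C) = \tr (H *m H).
  by rewrite -!mulmxA mxtrace_mulC -DCD !mulmxA.
have := H_le w0; have := trHH; rewrite /nrisk; move: w0 => x.
rewrite -scalemxAr dotZl dotZr dot_mulmx trmxK !mulmxA DCD.
move=> h1 h2; have := mulr_ge0 kappa_ge0 trH_ge0; lra.
Qed.

Lemma nrisk_ge_traceAA : s2 * \tr (A *m A) <= nrisk.
Proof.
rewrite /nrisk /loss_cov mxtraceD mxtraceZ.
by have := dot_ge0 w0; have := trGBG_ge0; lra.
Qed.

(** The only nonzero block of [M] is [G], so that [zeta^T M zeta] is [eps^T G b]. *)
Lemma cross_term_second_moment :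
  second_moment_le P
    (fun w => dot (errors w) (w0 + G *m tuple_col (b w))) (2 * s2 * nrisk).
Proof.
pose M : 'M[R]_(p + n) := block_mx 0 0 G 0.
have MC : M *m C = block_mx 0 0 (G *m B) 0.
  by rewrite /M /noise_cov mulmx_block !(mulmx0, mul0mx, addr0, add0r).
have MTC : M^T *m C = block_mx 0 (s2 *: G^T) 0 0.
  rewrite /M /noise_cov tr_block_mx !trmx0 mulmx_block.
  by rewrite !(mulmx0, mul0mx, addr0, add0r) mul_mx_scalar.
have := second_moment_chaos noise_gauss4 (col_mx 0 w0) M.
rewrite -!mulmxA MTC !mulmxA MC mulmx_block -[_ *m M *m C]mulmxA MC mulmx_block.
rewrite !(mulmx0, mul0mx, addr0, add0r) !mxtrace_block !mxtrace0 !add0r.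
rewrite noise_covE dot_col_mx mulmx0 dot0r add0r dotZr -scalemxAr mxtraceZ addr0.
rewrite (_ : (fun w => _) = (fun w => dot (errors w) (w0 + G *m tuple_col (b w)))).
  apply: second_moment_le_weaken.
  rewrite /nrisk /loss_cov mxtraceD mxtraceZ.
  by have := mulr_ge0 (sqr_ge0 s2) trAA_ge0; lra.
apply/funext => w; rewrite subr0 /noise /M mul_block_col !mul0mx !add0r addr0.
rewrite !dot_col_mx dot0r dotC dot0r !add0r !dotDr [dot w0 _]dotC; congr (_ + _).
Qed.

Definition observations (w : T) : 'cV[R]_n :=
  eta + Z *m tuple_col (b w) + errors w.

Notation Zb w := (Z *m tuple_col (b w)).

Let cross w := dot (errors w) (w0 + G *m tuple_col (b w)).
Let quad w := dot (errors w) (A *m errors w) - s2 * \tr A.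
Let energy w := dot (errors w) (errors w).

Lemma lossE w : loss A eta (Zb w) (observations w) = n%:R^-1 * nloss w.
Proof.
rewrite /loss /nloss dotE; congr (_ * _); apply: eq_bigr => i _.
rewrite -expr2 /observations !mulmxDr !mulmxBl !mul1mx -!mulmxA.
move: (Z *m _) (A *m eta) (A *m (Z *m _)) (A *m errors w) => z a1 a2 a3.
by rewrite !mxE; ring.
Qed.

Lemma residual_sumE w :
  ((observations w)^T *m ((1%:M - A) *m (1%:M - A)) *m observations w) 0 0 =
  nloss w + energy w + 2 * cross w - 2 * (quad w + s2 * \tr A).
Proof.
rewrite -/(bilin _ _ _) bilinE -mulmxA.
have cT : (1%:M - A)^T = 1%:M - A by rewrite linearB/= trmx1 AT.
rewrite -{1}cT -dot_mulmx.
have -> : (1%:M - A) *m observations w =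
   (w0 + (G *m tuple_col (b w) - A *m errors w)) + errors w.
  rewrite /observations !mulmxDr [(1%:M - A) *m errors w]mulmxBl mul1mx -mulmxA.
  by rewrite -!addrA [- _ + _]addrC.
rewrite /nloss /energy /cross /quad /= subrK !dotDl !dotDr !dotNl !dotNr.
rewrite [dot w0 (errors w)]dotC [dot (G *m _) (errors w)]dotC [dot (A *m _) (errors w)]dotC.
ring.
Qed.

Hypothesis n_gt0 : (0 < n)%N.
Notation mu := (n%:R^-1 * \tr A).

Lemma gcvE w : gcv A (observations w) = n%:R^-1 *
  ((nloss w + energy w + 2 * cross w - 2 * (quad w + s2 * (n%:R * mu))) / (1 - mu) ^+ 2).
Proof.
have n0 : n%:R != 0 :> R by rewrite pnatr_eq0 -lt0n.
rewrite /gcv residual_sumE linearB/= mxtrace1.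
have -> : n%:R^-1 * (n%:R - \tr A) = 1 - mu by rewrite mulrBr mulVf.
have -> : n%:R * mu = \tr A by rewrite mulrA mulfV// mul1r.
by rewrite mulrA.
Qed.

(** Outside of four exceptional events, the deterministic estimate applies;
    each of them is unlikely by Chebyshev's inequality, since the variances are
    at most of the order of [nrisk], while the thresholds are proportional to
    [nrisk]. The energy of the errors has variance of order [n], but it comes
    with a factor of order [mu], and [n mu ^ 2] is of order at most [nrisk]. *)
Lemma gcv_loss_deviation (e0 del : R) : 0 < e0 -> 0 < nrisk -> 0 <= del ->
  mu <= del -> mu ^+ 2 <= del * (n%:R^-1 * \tr (A *m A)) ->
  del <= 2^-1 -> del <= e0 / 128 ->
  (P [set w | (e0 * `|loss A eta (Zb w) (observations w)| <
     `|gcv A (observations w) - loss A eta (Zb w) (observations w)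
       - n%:R^-1 * ((errors w)^T *m errors w) 0 0|)%R] <=
   ((32 * kappa + 262 * s2 / (e0 / 68) ^+ 2) / nrisk)%:E)%E.
Proof.
move=> e00 rho0 del0 mud mu2 d2 de.
have nR0 : 0 < n%:R :> R by rewrite ltr0n.
have trA0 : 0 <= \tr A by apply: ge0_trace => v; exact: smoother_ge0.
have mu0 : 0 <= mu by rewrite mulr_ge0// invr_ge0 ltW.
set k := e0 / 68 * nrisk.
have k0 : 0 < k by rewrite mulr_gt0// divr_gt0.
have hW := nloss_concentration.
have hc := cross_term_second_moment.
have ha := second_moment_error_quad AT.
have he := second_moment_error_quad (trmx1 R n).
have hmu : s2 * (n%:R * mu ^+ 2) <= del * nrisk.
  apply: (@le_trans _ _ (s2 * (del * \tr (A *m A)))).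
    rewrite ler_pM2l// -ler_pdivlMl// mulrCA; exact: mu2.
  by rewrite mulrCA ler_wpM2l// nrisk_ge_traceAA.
have hge := second_moment_leZ (8 * mu) he.
pose BW := [set w | (nrisk / 2 < `|nloss w - nrisk|)%R].
pose Bc := [set w | (k < `|cross w|)%R].
pose Ba := [set w | (k < `|quad w|)%R].
pose Be := [set w | (k < `|8 * mu * (energy w - s2 * n%:R)|)%R].
have energy_trE w : dot (errors w) (1%:M *m errors w) - s2 * \tr (1%:M : 'M[R]_n) =
    energy w - s2 * n%:R by rewrite mul1mx mxtrace1.
have mnloss : measurable_fun setT nloss by exact: has_mean_measurable nloss_mean.
have menergy : measurable_fun setT energy.
  have [+ _] := he; move=> /(measurable_funD (measurable_cst (s2 * \tr (1%:M : 'M[R]_n)))).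
  apply: eq_measurable_fun => w _ /=; rewrite mul1mx /energy; ring.
set bad := [set w | _].
have badE : bad `<=` BW `|` Bc `|` (Ba `|` Be).
  move=> w; rewrite /bad/= gcvE lossE -/(dot _ _) -/(energy w).
  rewrite -!mulrBr !normrM (ger0_norm (_ : 0 <= n%:R^-1)); last by rewrite invr_ge0 ltW.
  rewrite mulrCA ltr_pM2l ?invr_gt0// => gap.
  apply: contrapT; rewrite /BW /Bc /Ba /Be/=.
  move=> /not_orP[/not_orP[/negP nW /negP nc] /not_orP[/negP na /negP ne]].
  move: nW nc na ne; rewrite -!leNgt => nW nc na ne.
  move: gap; apply/negP; rewrite -leNgt.
  rewrite (ger0_norm (dot_ge0 _ : 0 <= nloss w)).
  apply: (@gcv_loss_gap_le _ n%:R _ _ _ _ _ (energy w - s2 * n%:R) s2 nrisk del) => //.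
  by rewrite [n%:R * s2]mulrC subrK.
have mBW : measurable BW by apply: measurable_lt_norm; exact: measurable_funB.
have mBc : measurable Bc by apply: measurable_lt_norm; exact: hc.1.
have mBa : measurable Ba by apply: measurable_lt_norm; exact: ha.1.
have mBe : measurable Be.
  by apply: measurable_lt_norm; apply: measurable_funM => //; exact: measurable_funB.
have mcross : measurable_fun setT cross := hc.1.
have mquad : measurable_fun setT quad := ha.1.
have mbad : measurable bad.
  pose X w := nloss w + energy w + 2 * cross w - 2 * (quad w + s2 * (n%:R * mu)).
  have mX : measurable_fun setT X.
    apply: measurable_funB.
      by apply: measurable_funD; [exact: measurable_funD|exact: measurable_funM].
    by apply: measurable_funM => //; exact: measurable_funD.
  pose f w := `|n%:R^-1 * (X w * ((1 - mu) ^+ 2)^-1) - n%:R^-1 * nloss w - n%:R^-1 * energy w|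
    - e0 * `|n%:R^-1 * nloss w|.
  have mf : measurable_fun setT f.
    apply: measurable_funB; apply: measurableT_comp => //.
    - apply: measurable_funB; [apply: measurable_funB|].
      + by apply: measurable_funM => //; exact: measurable_funM.
      + exact: measurable_funM.
      + exact: measurable_funM.
    - apply: measurableT_comp => //; exact: measurable_funM.
  rewrite (_ : bad = f @^-1` `]0, +oo[).
    by rewrite -[_ @^-1` _]setTI; exact: mf.
  apply/seteqP; split=> w; rewrite /bad/= gcvE lossE -/(dot _ _) -/(energy w);
  by rewrite /f /X in_itv/= andbT subr_gt0.
apply: (@le_trans _ _ (P BW + P Bc + (P Ba + P Be))%E).
  apply: (@le_trans _ _ (P (BW `|` Bc `|` (Ba `|` Be)))).
    by apply: le_measure; rewrite ?inE//; do !apply: measurableU.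
  apply: (le_trans (measureU2 _ _ _)); [exact: measurableU|exact: measurableU|].
  by apply: leeD; apply: (le_trans (measureU2 _ _ _)).
have pW := Chebyshev_le (_ : 0 < nrisk / 2) hW.
have pc := Chebyshev_le k0 hc.
have pa := Chebyshev_le k0 ha.
have pe := Chebyshev_le k0 hge.
rewrite (_ : [set w | _] = Be) in pe; last first.
  by apply/seteqP; split=> w; rewrite /Be/= energy_trE.
apply: (le_trans (leeD (leeD (pW _) pc) (leeD pa pe))); first by rewrite divr_gt0.
rewrite -!EFinD lee_fin mulmx1 mxtrace1.
set q := e0 / 68; have q0 : 0 < q by rewrite divr_gt0.
have tA : 4 * s2 ^+ 2 * \tr (A *m A) <= 4 * s2 * nrisk.
  have -> : 4 * s2 ^+ 2 * \tr (A *m A) = 4 * s2 * (s2 * \tr (A *m A)) by ring.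
  by rewrite ler_wpM2l ?nrisk_ge_traceAA// mulr_ge0// (ltW s2_gt0).
have tE : (8 * mu) ^+ 2 * (4 * s2 ^+ 2 * n%:R) <= 256 * s2 * nrisk.
  have -> : (8 * mu) ^+ 2 * (4 * s2 ^+ 2 * n%:R) = 256 * s2 * (s2 * (n%:R * mu ^+ 2)).
    by ring.
  rewrite ler_wpM2l ?mulr_ge0 ?(ltW s2_gt0)// (le_trans hmu)//.
  by rewrite ler_piMl ?(ltW rho0)//; lra.
apply: (@le_trans _ _ (8 * kappa * nrisk / (nrisk / 2) ^+ 2 + 2 * s2 * nrisk / k ^+ 2 +
  (4 * s2 * nrisk / k ^+ 2 + 256 * s2 * nrisk / k ^+ 2))).
  rewrite lerD2l lerD// ler_wpM2r// invr_ge0 exprn_ge0// ltW//.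
rewrite le_eqVlt; apply/orP; left; apply/eqP; rewrite /k -/q; field.
by rewrite !gt_eqF.
Qed.

End model.

(** * The limit *)

(** Let [mu] and [t] be the normalized traces of [A] and [A ^ 2]. The eigenvalues
    of [A] lie in [[0, 1]], hence [t <= mu], and [del = mu ^ 2 / t] is at least [mu].
    When [t = 0], division by zero makes [del = 0], and indeed [A] has a zero
    diagonal. *)
Lemma smoother_trace_ratio (R : realType) n (A : 'M[R]_n) (del : R) :
  smoother A -> (0 < n)%N ->
  del = (n%:R^-1 * \tr A) ^+ 2 / (n%:R^-1 * \tr (A *m A)) ->
  [/\ 0 <= del, n%:R^-1 * \tr A <= del &
      (n%:R^-1 * \tr A) ^+ 2 <= del * (n%:R^-1 * \tr (A *m A))].
Proof.
move=> As n0 dE; have [AT Ac] := As.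
have nV : 0 < n%:R^-1 :> R by rewrite invr_gt0 ltr0n.
have AAE v : dot v (A *m A *m v) = dot (A *m v) (A *m v).
  by rewrite -mulmxA -{1}AT -dot_mulmx.
have AA0 : 0 <= \tr (A *m A) by apply: ge0_trace => v; rewrite AAE dot_ge0.
have AAA : \tr (A *m A) <= \tr A by apply: le_trace => v; rewrite AAE.
set mu := _ * \tr A in dE *; set t := _ * \tr (A *m A) in dE *.
have t0 : 0 <= t by rewrite mulr_ge0// ltW.
have tmu : t <= mu by rewrite ler_pM2l.
have mu0 : 0 <= mu by apply: le_trans tmu.
have d0 : 0 <= del by rewrite dE divr_ge0// sqr_ge0.
have [tz|tnz] := eqVneq t 0; last first.
  have tp : 0 < t by rewrite lt_def tnz.
  split=> //; last by rewrite dE divfK.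
  by rewrite dE ler_pdivlMr// expr2 ler_wpM2l.
suff muz : mu = 0 by rewrite muz expr0n/= mulr_ge0.
have trz : \tr (A *m A) = 0.
  by apply/eqP; move/eqP: tz; rewrite mulf_eq0 gt_eqF.
have Az i : A i i = 0.
  suff Ai : A *m delta_mx i 0 = 0 :> 'cV_n by rewrite -dot_mx_delta Ai dot0r.
  apply: dot_eq0; rewrite -AAE dot_mx_delta.
  by apply: (psumr_eq0P _ trz) => // j _; rewrite -dot_mx_delta AAE dot_ge0.
by rewrite /mu /mxtrace big1 ?mulr0.
Qed.

Theorem theorem4p2 (R : realType) (X : Type) (eta : X -> R)
  (sigma2 : R) (sigma2_gt0 : 0 < sigma2)
  (H : set (X -> R)) (J : (X -> R) -> (X -> R) -> R)
  (J_sip : semi_inner_product_on H J)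
  (p q : nat -> nat)
  (x : forall n, 'I_n -> X) (Z : forall n, 'M[R]_(n, p n))
  (B : forall n, 'M[R]_(p n))
  (B_bounded : exists K : R, forall n a, eigenvalue (B n) a -> a <= K)
  (d : nat -> measure_display) (T : forall n, measurableType (d n))
  (P : forall n, probability (T n) R)
  (b : forall n, {RV P n >-> (p n).-tuple R})
  (eps : forall n, 'I_n -> {RV P n >-> R})
  (b_normal : forall n, centered_normal_rvec (B n) (b n))
  (eps_normal : forall n i, centered_normal_rv (P n) sigma2 (eps n i))
  (b_eps_indep : forall n, mutually_independent (b n) (eps n))
  (xi : forall n, 'I_(q n) -> X -> R) (xi_dom : forall n j, H (xi n j))
  (lambda : nat -> R) (lambda_gt0 : forall n, 0 < lambda n)
  (Sigma : forall n, 'M[R]_(p n)) (Sigma_posdef : forall n, posdef (Sigma n)) :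
  let F n := basis_mx (xi n) (x n) in
  let Q n := penalty_mx J (xi n) in
  let A n := smoothing_mx (F n) (Q n) (lambda n) (Z n) (Sigma n) in
  let At n := fixed_smoothing_mx (F n) (Q n) (lambda n) in
  let etav n : 'cV[R]_n := \col_i eta (x n i) in
  let Zb n (w : T n) : 'cV[R]_n := Z n *m tuple_col (b n w) in
  let epsv n (w : T n) : 'cV[R]_n := \col_i eps n i w in
  let Y n (w : T n) : 'cV[R]_n := etav n + Zb n w + epsv n w in
  let L1 n (w : T n) : R := loss (A n) (etav n) (Zb n w) (Y n w) in
  let R1 n : \bar R := 'E_(P n)[L1 n]%E in
  let V n (w : T n) : R := gcv (A n) (Y n w) in
  (forall n, normal_eq_solvable (F n) (Q n) (lambda n) (Z n) (Sigma n)) ->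
  (exists K : R, forall n a,
     eigenvalue (Sigma n *m
                 invmx ((Z n)^T *m (1%:M - At n) *m Z n + Sigma n) *m
                 Sigma n) a ->
     a <= K) ->
  (n%:R%:E * R1 n)%E @[n --> \oo] --> +oo%E ->
  (n%:R^-1 * \tr (A n)) ^+ 2 / (n%:R^-1 * \tr (A n *m A n)) @[n --> \oo]
    --> (0 : R) ->
  little_op P
    (fun n w => V n w - L1 n w
                - n%:R^-1 * ((epsv n w)^T *m epsv n w) 0 0)
    L1.
Proof.
move=> F Q A At etav Zb epsv Y L1 R1 V _ [KZ KZ_le] C2 C3 e0 e0_gt0.
have [KB KB_le] := B_bounded.
have Qn n : nonnegdef (Q n) by exact: penalty_mx_nonneg J_sip (xi_dom n).
have As n : smoother (A n).
  exact: smoothing_mx_smoother (Qn n) (lambda_gt0 n) (Sigma_posdef n).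
(* When all the dimensions are zero, the bounds may be negative. *)
pose kB := Num.max KB 0; pose kZ := Num.max KZ 0.
have kB0 : 0 <= kB by rewrite le_max lexx orbT.
have kZ0 : 0 <= kZ by rewrite le_max lexx orbT.
have BK n v : dot v (B n *m v) <= kB * dot v v.
  apply: (le_trans (rayleigh (b_normal n).1.1 (KB_le n) v)).
  by rewrite ler_wpM2r ?dot_ge0// le_max lexx.
have GK n v : dot ((1%:M - A n) *m Z n *m v) ((1%:M - A n) *m Z n *m v) <=
    kZ * dot v v.
  have RR := residual_random_effects (F n) (Z n) (Qn n) (lambda_gt0 n) (Sigma_posdef n) v.
  apply: (le_trans RR).
  have sym := profile_mx_sym (F n) (Z n) (Qn n) (lambda_gt0 n) (Sigma_posdef n).
  apply: (le_trans (rayleigh sym (KZ_le n) v)).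
  by rewrite ler_wpM2r ?dot_ge0// le_max lexx.
pose rho n := nrisk (B n) sigma2 (A n) (Z n) (etav n).
pose del n := (n%:R^-1 * \tr (A n)) ^+ 2 / (n%:R^-1 * \tr (A n *m A n)).
have rhoE n : (0 < n)%N -> (n%:R%:E * R1 n)%E = (rho n)%:E.
  move=> n0; rewrite /R1 unlock.
  have [I E] := nloss_mean sigma2_gt0 (b_normal n) (eps_normal n) (@b_eps_indep n)
    (Z n) (etav n) (As n).
  have nz : n%:R != 0 :> R by rewrite pnatr_eq0 -lt0n.
  under eq_integral => w _ do rewrite /L1 /Y [loss _ _ _ _](lossE (b n) (eps n)) EFinM.
  rewrite integralZl// E -!EFinM mulrA mulfV// mul1r//.
have rho_oo : rho n @[n --> \oo] --> +oo.
  apply/cvgryPge => M; move/cvgeyPge : C2 => /(_ M) C2M.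
  near=> n; rewrite -lee_fin -rhoE; last by near: n; exact: nbhs_infty_gt.
  by near: n.
pose kappa := kB * kZ + sigma2.
pose Kc := 32 * kappa + 262 * sigma2 / (e0 / 68) ^+ 2.
have bound0 : (Kc * (rho n)^-1)%:E @[n --> \oo] --> 0%E.
  apply: cvg_EFin; first exact: nearW.
  rewrite -[X in _ --> X](mulr0 Kc); apply: cvgM; first exact: cvg_cst.
  apply/gtr0_cvgV0 => //.
  by move/cvgryPgt : rho_oo => /(_ 0).
apply: (squeeze_cvge _ (cvg_cst 0%E) bound0).
have h2 : 0 < 2^-1 :> R by rewrite invr_gt0.
have h128 : 0 < e0 / 128 by rewrite divr_gt0.
near=> n; apply/andP; split; first exact: measure_ge0.
have n0 : (0 < n)%N by near: n; exact: nbhs_infty_gt.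
have rn : 0 < rho n by near: n; move/cvgryPgt : rho_oo => /(_ 0).
have [d0 mud mu2] := smoother_trace_ratio (As n) n0 (erefl (del n)).
have d2 : del n <= 2^-1.
  rewrite -[del n]ger0_norm// ltW//; near: n.
  by move/cvgr0_norm_lt : C3 => /(_ _ h2).
have d128 : del n <= e0 / 128.
  rewrite -[del n]ger0_norm// ltW//; near: n.
  by move/cvgr0_norm_lt : C3 => /(_ _ h128).
exact: (gcv_loss_deviation sigma2_gt0 (b_normal n) (eps_normal n) (@b_eps_indep n)
  (As n) kB0 kZ0 (BK n) (GK n) n0 e0_gt0 rn d0 mud mu2 d2 d128).
Unshelve. all: by end_near. Qed.
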